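(* Let $G$ be a finitely generated group. Then, for all $k\ge1$, $$\mathcal{W}_k(G)=\mathrm{supp}\Big(\bigwedge^k\big(B_{\mathbb{Q}}(G)\otimes\mathbb{C}\big)\Big),$$ at least away from the identity $1\in\mathbb{T}^0_G$; that is, the two subsets of $\mathbb{T}^0_G$ have the same intersection with $\mathbb{T}^0_G\setminus\{1\}$.
   Context: $\mathbb{T}_G=\mathrm{Hom}(G,\mathbb{C}^* )$ is the character group and $\mathbb{T}^0_G$ its identity component, identified with $\mathrm{Hom}(G_{\mathrm{abf}},\mathbb{C}^* )$ and with the maximal spectrum of $\mathbb{C}[G_{\mathrm{abf}}]$, where $G_{\mathrm{abf}}=G_{\mathrm{ab}}/\mathrm{Tors}(G_{\mathrm{ab}})$. For $k\ge1$, $\mathcal{V}_k(G)=\{\rho\in\mathbb{T}_G:\dim_{\mathbb{C}}H_1(G,\mathbb{C}_\rho)\ge k\}$, where $\mathbb{C}_\rho$ is $\mathbb{C}$ with $G$-action via $\rho$, and $\mathcal{W}_k(G)=\mathcal{V}_k(G)\cap\mathbb{T}^0_G$. For $S\subseteq G$, $\sqrt{S}=\{g\in G: g^m\in S\text{ for some }m>0\}$; $G'_{\mathbb{Q}}=\sqrt{[G,G]}$, $G''_{\mathbb{Q}}=\sqrt{[G'_{\mathbb{Q}},G'_{\mathbb{Q}}]}$, and $G/G'_{\mathbb{Q}}=G_{\mathrm{abf}}$. The rational Alexander invariant $B_{\mathbb{Q}}(G)=G'_{\mathbb{Q}}/G''_{\mathbb{Q}}$ is a $\mathbb{Z}[G_{\mathrm{abf}}]$-module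 via conjugation, so $B_{\mathbb{Q}}(G)\otimes\mathbb{C}$ is a $\mathbb{C}[G_{\mathrm{abf}}]$-module; the exterior power is taken over $\mathbb{C}[G_{\mathrm{abf}}]$. The support of an $R$-module $M$ is the set of maximal ideals $\mathfrak{m}$ of $R$ with $M_{\mathfrak{m}}\ne0$. *)

(* Defs.v *)
From HB Require Import structures.
From mathcomp Require Import all_boot all_order all_algebra.
From mathcomp Require Import finmap monalg complex.
From mathcomp Require Import boolp classical_sets reals topology normedtype.
Set Implicit Arguments.
Unset Strict Implicit.
Unset Printing Implicit Defensive.
Import GRing.Theory Num.Theory.
Import numFieldNormedType.Exports.
Local Open Scope quotient_scope.
Local Open Scope classical_set_scope.
Local Open Scope group_scope.

Section Subgroups.
Variable G : groupType.
Implicit Types H K S : set G.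

Definition subgroup H : Prop :=
  [/\ H 1, forall x y, H x -> H y -> H (x * y) & forall x, H x -> H x^-1].

Definition generated S : set G := smallest subgroup S.

Definition finitely_generated : Prop :=
  exists s : seq G, generated [set x | x \in s] = setT.

Definition commutator H K : set G :=
  generated [set z | exists x y, [/\ H x, K y & z = [~ x, y]]].

Definition radical S : set G := [set g | exists2 m, (0 < m)%N & S (g ^+ m)].

Definition rational_derived H : set G := radical (commutator H H).

Lemma generated_subgroup S : subgroup (generated S).
Proof.
split=> [H [[]]//|x y Gx Gy H [HH SH]|x Gx H [HH SH]]; case: (HH) => _ HM HV.
  by apply: HM; [apply: Gx | apply: Gy].
by apply: HV; apply: Gx.
Qed.

Lemma commutator_sub H : subgroup H -> commutator H H `<=` H.
Proof.
move=> HH z; apply; split=> // _ [x [y [Hx Hy ->]]].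
case: HH => _ HM HV; rewrite commgEl conjgE.
by apply: (HM) => //; [apply: HV | apply: (HM); [apply: HV | apply: HM]].
Qed.

End Subgroups.

(* G'_Q and G''_Q; the roots in G''_Q are taken in G. *)
Definition GQ1 (G : groupType) : set G := rational_derived [set: G].
Definition GQ2 (G : groupType) : set G := rational_derived (@GQ1 G).

(* Subgroups containing all commutators: exactly the normal subgroups with
   abelian quotient. *)
Record abelian_kernel (H : groupType) := AbelianKernel {
  ak_set :> H -> Prop;
  ak_subgroup : subgroup ak_set;
  ak_comm : forall x y, ak_set [~ x, y] }.

Section AbelianQuotient.
Variables (H : groupType) (N : abelian_kernel H).

Lemma ak1 : N 1. Proof. by case: (ak_subgroup N). Qed.
Lemma akM x y : N x -> N y -> N (x * y).
Proof. by case: (ak_subgroup N) => _ + _; apply. Qed.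
Lemma akV x : N x -> N x^-1. Proof. by case: (ak_subgroup N) => _ _; apply. Qed.
Lemma akJ x y : N x -> N (x ^ y).
Proof. by move=> Nx; rewrite -(mulVKg x (x ^ y)); apply: akM => //; apply: ak_comm. Qed.

Definition ak_rel : rel H := [rel x y | `[< N (x^-1 * y) >]].

Lemma ak_rel_equiv : equiv_class_of ak_rel.
Proof.
split=> [x|x y|y x z] /=; first by apply/asboolP; rewrite mulVg; exact: ak1.
  by apply/asboolP/asboolP => /akV; rewrite invgM invgK.
move=> /asboolP Nxy /asboolP Nyz; apply/asboolP.
by have := akM Nxy Nyz; rewrite mulgA -(mulgA x^-1) mulgV mulg1.
Qed.

Canonical ak_rel_canonical := EquivRelPack ak_rel_equiv.

Definition abquot : Type := {eq_quot ak_rel}.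
HB.instance Definition _ := Choice.on abquot.
HB.instance Definition _ := Quotient.on abquot.

Definition abclass (x : H) : abquot := \pi_abquot x.

Lemma abclassP x y : abclass x = abclass y <-> N (x^-1 * y).
Proof. 
split=> [/eqmodP/asboolP//|Nxy]; apply/eqmodP; exact/asboolP.
Qed.

Lemma abclass_ind (P : abquot -> Prop) : (forall x, P (abclass x)) -> forall a, P a.
Proof. by move=> Px a; rewrite -[a]reprK; exact: Px. Qed.

Lemma abclass_repr a : abclass (repr a) = a. Proof. exact: reprK. Qed.

Definition abadd (a b : abquot) : abquot := abclass (repr a * repr b).
Definition abopp (a : abquot) : abquot := abclass (repr a)^-1.

Lemma abclass_eqM x x' y y' : abclass x = abclass x' -> abclass y = abclass y' ->
  abclass (x * y) = abclass (x' * y').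
Proof.
move=> /abclassP Nx /abclassP Ny; apply/abclassP.
suff -> : (x * y)^-1 * (x' * y') = (x^-1 * x') ^ y * (y^-1 * y').
  by apply: akM => //; apply: akJ.
by rewrite invgM conjgE -!mulgA mulVKg.
Qed.

Lemma abclass_eqV x x' : abclass x = abclass x' -> abclass x^-1 = abclass x'^-1.
Proof.
move=> /esym/abclassP Nx; apply/abclassP; rewrite invgK.
suff -> : x * x'^-1 = (x'^-1 * x) ^ x'^-1 by apply: akJ.
by rewrite conjgE invgK -!mulgA mulVKg.
Qed.

Lemma abclassM x y : abadd (abclass x) (abclass y) = abclass (x * y).
Proof. by apply: abclass_eqM; rewrite abclass_repr. Qed.

Lemma abclassV x : abopp (abclass x) = abclass x^-1.
Proof. by apply: abclass_eqV; rewrite abclass_repr. Qed.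

Fact abaddA : associative abadd.
Proof.
by elim/abclass_ind=> x; elim/abclass_ind=> y; elim/abclass_ind=> z; rewrite !abclassM mulgA.
Qed.

Fact abaddC : commutative abadd.
Proof.
elim/abclass_ind=> x; elim/abclass_ind=> y; rewrite !abclassM.
by apply/abclassP; rewrite invgM -mulgA; exact: (ak_comm N y x).
Qed.

Fact abadd0 : left_id (abclass 1) abadd.
Proof. by elim/abclass_ind=> x; rewrite abclassM mul1g. Qed.

Fact abaddN : left_inverse (abclass 1) abopp abadd.
Proof. by elim/abclass_ind=> x; rewrite abclassV abclassM mulVg. Qed.

HB.instance Definition _ :=
  GRing.isZmodule.Build abquot abaddA abaddC abadd0 abaddN.

Lemma abclassD x y : abclass (x * y) = (abclass x + abclass y)%R.
Proof. by rewrite -abclassM. Qed.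

Lemma abclass1 : abclass 1 = 0%R. Proof. by []. Qed.

Lemma abclassN x : abclass x^-1 = (- abclass x)%R.
Proof. by rewrite -abclassV. Qed.

Lemma abclassX x n : abclass (x ^+ n) = (abclass x *+ n)%R.
Proof. by elim: n => [|n IHn]; rewrite ?expgS ?abclassD ?IHn ?mulrS. Qed.

Lemma abclass_eq0 x : abclass x = 0%R <-> N x.
Proof.
rewrite -abclass1 abclassP mulg1; split=> [/akV|/akV//]; by rewrite invgK.
Qed.

End AbelianQuotient.

Section Radicals.
Variables (H : groupType) (N : abelian_kernel H).

Lemma radicalP x :
  radical N x <-> exists2 m, (0 < m)%N & (abclass N x *+ m = 0)%R.
Proof.
by split=> -[m m0 Nx]; exists m => //; move: Nx; rewrite -abclassX abclass_eq0.
Qed.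

Fact radical_subgroup : subgroup (radical N).
Proof.
split=> [|x y /radicalP[m m0 xm] /radicalP[n n0 yn]|x /radicalP[m m0 xm]];
  apply/radicalP.
- by exists 1%N => //; rewrite abclass1 mul0rn.
- exists (m * n)%N; first by rewrite muln_gt0 m0.
  by rewrite abclassD mulrnDl mulrnA xm mul0rn add0r mulnC mulrnA yn mul0rn.
- by exists m => //; rewrite abclassN mulNrn xm oppr0.
Qed.

Fact radical_comm x y : radical N [~ x, y].
Proof. by exists 1%N => //; apply: ak_comm. Qed.

End Radicals.

Section RationalDerived.
Variable G : groupType.

Fact commutatorT_comm (x y : G) : commutator setT setT [~ x, y].
Proof. by move=> K [_ SK]; apply: SK; exists x, y. Qed.

Definition derived_kernel : abelian_kernel G :=
  AbelianKernel (generated_subgroup _) commutatorT_comm.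

Definition GQ1_kernel : abelian_kernel G :=
  @AbelianKernel G (@GQ1 G)
    (radical_subgroup derived_kernel) (radical_comm derived_kernel).

Definition GQ1_pred : {pred G} := fun x => `[< GQ1 x >].

Fact GQ1_closed : group_closed GQ1_pred.
Proof.
split=> [|x y /asboolP Gx /asboolP Gy]; apply/asboolP; first exact: (ak1 GQ1_kernel).
by apply: (@akM _ GQ1_kernel) => //; apply: (@akV _ GQ1_kernel).
Qed.

Definition GQ1_type : Type := {x : G | x \in GQ1_pred}.
HB.instance Definition _ := SubChoice.on GQ1_type.
HB.instance Definition _ :=
  SubChoice_isSubGroup.Build G GQ1_pred GQ1_type GQ1_closed.

Definition GQ1_val (x : GQ1_type) : G := val x.

Lemma GQ1_valP x : GQ1 (GQ1_val x).
Proof. exact/asboolP/(valP x). Qed.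

Lemma GQ1_val_inj : injective GQ1_val. Proof. exact: val_inj. Qed.

Lemma GQ1_val_surj g : GQ1 g -> exists x, GQ1_val x = g.
Proof. by move=> /asboolT Gg; exists (Sub g Gg); apply: SubK. Qed.

Lemma GQ1_val1 : GQ1_val 1 = 1. Proof. exact: gmulf1. Qed.
Lemma GQ1_valM : {morph GQ1_val : x y / x * y}. Proof. exact: gmulfM. Qed.
Lemma GQ1_valV : {morph GQ1_val : x / x^-1}. Proof. exact: gmulfV. Qed.
Lemma GQ1_valX n : {morph GQ1_val : x / x ^+ n}. Proof. exact: gmulfXn. Qed.
Lemma GQ1_valR : {morph GQ1_val : x y / [~ x, y]}. Proof. exact: gmulfR. Qed.

Lemma GQ1J x g : @GQ1 G x -> GQ1 (x ^ g).
Proof. exact: (@akJ _ GQ1_kernel). Qed.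

Lemma commutator_GQ1J x g :
  commutator (@GQ1 G) (@GQ1 G) x -> commutator (@GQ1 G) (@GQ1 G) (x ^ g).
Proof.
move=> Gx K [[K1 KM KV] SK].
suff : [set y | K (y ^ g)] x by [].
apply: Gx; split.
  split=> [|y z /= Ky Kz|y /= Ky]; first by rewrite /= conj1g.
    by rewrite conjMg; apply: KM.
  by rewrite conjVg; apply: KV.
move=> _ [y [z [Gy Gz ->]]] /=; rewrite conjRg; apply: SK.
by exists (y ^ g), (z ^ g); split=> //; apply: GQ1J.
Qed.

Lemma GQ2J x g : @GQ2 G x -> GQ2 (x ^ g).
Proof.
by move=> [m m0 Gx]; exists m => //; rewrite -conjXg; apply: commutator_GQ1J.
Qed.

Fact GQ1_derived_subgroup :
  subgroup [set x | commutator (@GQ1 G) (@GQ1 G) (GQ1_val x)].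
Proof.
have [C1 CM CV] := generated_subgroup
  [set z | exists x y, [/\ @GQ1 G x, GQ1 y & z = [~ x, y]]].
split=> [|x y Cx Cy|x Cx]; rewrite /mkset.
- by rewrite GQ1_val1.
- by rewrite GQ1_valM; apply: CM.
by rewrite GQ1_valV; apply: CV.
Qed.

Fact GQ1_derived_comm x y : commutator (@GQ1 G) (@GQ1 G) (GQ1_val [~ x, y]).
Proof.
rewrite GQ1_valR => K [_ SK]; apply: SK.
by exists (GQ1_val x), (GQ1_val y); split=> //; apply: GQ1_valP.
Qed.

Definition GQ1_derived_kernel : abelian_kernel GQ1_type :=
  AbelianKernel GQ1_derived_subgroup GQ1_derived_comm.

Fact radical_derivedE :
  radical GQ1_derived_kernel = [set x | GQ2 (GQ1_val x)].
Proof.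
by apply/seteqP; split=> x [m m0]; rewrite /= /mkset => Gx; exists m => //;
   move: Gx; rewrite /= /mkset GQ1_valX.
Qed.

Fact GQ2_subgroup : subgroup [set x | GQ2 (GQ1_val x)].
Proof. by rewrite -radical_derivedE; apply: radical_subgroup. Qed.

Fact GQ2_comm x y : [set x | GQ2 (GQ1_val x)] [~ x, y].
Proof. by rewrite -radical_derivedE; apply: radical_comm. Qed.

Definition GQ2_kernel : abelian_kernel GQ1_type :=
  AbelianKernel GQ2_subgroup GQ2_comm.

Definition Gabf : Type := abquot GQ1_kernel.
HB.instance Definition _ := GRing.Zmodule.on Gabf.
HB.instance Definition _ := Quotient.on Gabf.

Definition BQ : Type := abquot GQ2_kernel.
HB.instance Definition _ := GRing.Zmodule.on BQ.
HB.instance Definition _ := Quotient.on BQ.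

Fact conj_subproof g x : GQ1_val x ^ g^-1 \in GQ1_pred.
Proof. exact/asboolP/GQ1J/GQ1_valP. Qed.

(* y ^ h denotes h^-1 y h, so this is g x g^-1. *)
Definition conjGQ1 g x : GQ1_type := Sub (GQ1_val x ^ g^-1) (conj_subproof g x).

Lemma GQ1_val_conj g x : GQ1_val (conjGQ1 g x) = GQ1_val x ^ g^-1.
Proof. exact: SubK. Qed.

Definition conjBQ (a : Gabf) (b : BQ) : BQ :=
  abclass GQ2_kernel (conjGQ1 (repr a) (repr b)).

Lemma conjBQ_class g x :
  conjBQ (abclass _ g) (abclass _ x) = abclass GQ2_kernel (conjGQ1 g x).
Proof.
have /abclassP := abclass_repr (abclass GQ1_kernel g).
have /abclassP := abclass_repr (abclass GQ2_kernel x).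
rewrite /conjBQ; set y := repr _; set h := repr _ => Ny Nh.
have hE : g = h * (h^-1 * g) by rewrite mulVKg.
have [k kE] := GQ1_val_surj Nh.
apply/abclassP; rewrite /= /mkset GQ1_valM GQ1_valV !GQ1_val_conj {}hE -kE.
have -> : (GQ1_val y ^ h^-1)^-1 * GQ1_val x ^ (h * GQ1_val k)^-1 =
    GQ1_val (y^-1 * x * [~ x, k^-1]) ^ h^-1.
  rewrite GQ1_valM GQ1_valR (GQ1_valM y^-1) !GQ1_valV (invgM h) conjgM -conjVg -conjMg.
  by congr (_ ^ _); rewrite commgEl -!mulgA mulVKg.
by apply: GQ2J; apply: (@akM _ GQ2_kernel) => //; apply: (@ak_comm _ GQ2_kernel).
Qed.

Lemma conjBQD a : {morph conjBQ a : b c / (b + c)%R}.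
Proof.
move: a; elim/abclass_ind=> g; elim/abclass_ind=> x; elim/abclass_ind=> y.
rewrite -abclassD !conjBQ_class -abclassD; congr abclass.
by apply: GQ1_val_inj; rewrite GQ1_valM !GQ1_val_conj GQ1_valM conjMg.
Qed.

Lemma conjBQ0 : conjBQ 0%R =1 id.
Proof.
elim/abclass_ind=> x; rewrite -[0%R]/(abclass GQ1_kernel 1) conjBQ_class.
by congr abclass; apply: GQ1_val_inj; rewrite GQ1_val_conj invg1 conjg1.
Qed.

Lemma conjBQA a b : conjBQ (a + b)%R =1 conjBQ a \o conjBQ b.
Proof.
move: a b; elim/abclass_ind=> g; elim/abclass_ind=> h; elim/abclass_ind=> x /=.
rewrite -abclassD !conjBQ_class; congr abclass.
by apply: GQ1_val_inj; rewrite !GQ1_val_conj invgM conjgM.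
Qed.

End RationalDerived.

Local Open Scope ring_scope.

(* {malg K[X]} is the free K-module on X, with basis << x >>. *)
Section FreeModule.
Variables (K : nzRingType) (X : choiceType) (V : lmodType K) (f : X -> V).

Definition mlift (z : {malg K[X]}) : V := \sum_(x <- msupp z) z@_x *: f x.

Lemma mliftEw (z : {malg K[X]}) (d : {fset X}) :
  (msupp z `<=` d)%fset -> mlift z = \sum_(x <- d) z@_x *: f x.
Proof.
move=> zd; rewrite /mlift; apply: big_fset_incl => // x _ /mcoeff_outdom ->.
by rewrite scale0r.
Qed.

Fact mlift_is_linear : linear mlift.
Proof.
move=> c u v; pose d := (msupp (c *: u + v) `|` (msupp u `|` msupp v))%fset.
have le1 : (msupp (c *: u + v) `<=` d)%fset by apply: fsubsetUl.
have le2 : (msupp u `<=` d)%fset by rewrite /d fsetUCA fsubsetUl.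
have le3 : (msupp v `<=` d)%fset by rewrite /d fsetUA fsubsetUr.
rewrite (mliftEw le1) (mliftEw le2) (mliftEw le3) scaler_sumr -big_split /=.
by apply: eq_bigr => x _; rewrite mcoeffD mcoeffZ scalerDl scalerA.
Qed.

HB.instance Definition _ :=
  GRing.isLinear.Build K {malg K[X]} V *:%R mlift mlift_is_linear.

Lemma mliftU x : mlift << x >> = f x.
Proof.
rewrite (mliftEw (d := [fset x]%fset)) ?msuppU_le// big_seq_fset1.
by rewrite mcoeffUU scale1r.
Qed.

End FreeModule.

Lemma malgUZ (K : nzRingType) (X : choiceType) (c : K) (x : X) :
  << c *g x >> = c *: << x >> :> {malg K[X]}.
Proof. by apply/malgP => y; rewrite mcoeffZ !mcoeffU mulrnAr mulr1. Qed.

Lemma mlift_uniq (K : nzRingType) (X : choiceType) (V : lmodType K)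
    (g h : {linear {malg K[X]} -> V}) :
  (forall x, g << x >> = h << x >>) -> g =1 h.
Proof.
move=> gh z; rewrite [z]monalgE !linear_sum; apply: eq_bigr => x _.
by rewrite malgUZ !linearZ /= gh.
Qed.

Section QuotientModule.
Variables (R : nzRingType) (M : lmodType R).
Implicit Types S N : set M.

Definition submodule N : Prop :=
  N 0 /\ forall a u v, N u -> N v -> N (a *: u + v).

Definition submod_span S : set M := smallest submodule S.

Lemma span_submodule S : submodule (submod_span S).
Proof.
split=> [N [[]]//|a u v Su Sv N NS]; have [[_ Na] _] := NS.
by apply: Na; [apply: Su | apply: Sv].
Qed.

Lemma sub_span S : S `<=` submod_span S.
Proof. by move=> x Sx N [_]; apply. Qed.

Lemma span_min S N : submodule N -> S `<=` N -> submod_span S `<=` N.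
Proof. by move=> HN SN x; apply. Qed.

Variable S : set M.

Definition span_pred : {pred M} := fun x => `[< submod_span S x >].

Fact span_pred_closed : zmod_closed span_pred.
Proof.
have [S0 Sa] := span_submodule S.
split=> [|x y /asboolP Sx /asboolP Sy]; apply/asboolP => //.
by rewrite -scaleN1r addrC; apply: Sa.
Qed.
HB.instance Definition _ := GRing.isZmodClosed.Build M span_pred span_pred_closed.

Definition modquot : Type := Quotient.quot span_pred.
HB.instance Definition _ := GRing.Zmodule.on modquot.

Definition modclass (x : M) : modquot := \pi_(Quotient.quot span_pred) x.

Fact modclass_is_additive : zmod_morphism modclass.
Proof. by move=> x y; rewrite /modclass raddfB. Qed.

HB.instance Definition _ :=
  GRing.isZmodMorphism.Build M modquot modclass modclass_is_additive.

Lemma modclass_repr (q : modquot) : modclass (repr q) = q.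
Proof. exact: reprK. Qed.

Lemma modclass_ind (P : modquot -> Prop) :
  (forall x, P (modclass x)) -> forall q, P q.
Proof. by move=> Px q; rewrite -[q]modclass_repr. Qed.

Lemma modclassP x y : modclass x = modclass y <-> submod_span S (x - y).
Proof.
split=> [/eqP|Sxy]; first by rewrite -Quotient.idealrBE => /asboolP.
by apply/eqP; rewrite -Quotient.idealrBE; apply/asboolP.
Qed.

Lemma modclass_eq0 x : modclass x = 0 <-> submod_span S x.
Proof. by rewrite -[0](raddf0 modclass) modclassP subr0. Qed.

Definition modscale (a : R) (q : modquot) : modquot := modclass (a *: repr q).

Lemma modclassZ a x : modscale a (modclass x) = modclass (a *: x).
Proof.
apply/modclassP; rewrite -scalerBr; have [S0 Sa] := span_submodule S.
rewrite -[_ *: _]addr0; apply: Sa => //.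
by apply/modclassP; rewrite modclass_repr.
Qed.

Fact modscaleA a b q : modscale a (modscale b q) = modscale (a * b) q.
Proof. by elim/modclass_ind: q => x; rewrite !modclassZ scalerA. Qed.
Fact modscale1 : left_id 1 modscale.
Proof. by elim/modclass_ind => x; rewrite modclassZ scale1r. Qed.
Fact modscaleDr : right_distributive modscale +%R.
Proof.
move=> a; elim/modclass_ind => x; elim/modclass_ind => y.
by rewrite -raddfD !modclassZ scalerDr raddfD.
Qed.
Fact modscaleDl q : {morph modscale^~ q : a b / a + b}.
Proof.
by elim/modclass_ind: q => x a b; rewrite !modclassZ scalerDl raddfD.
Qed.

HB.instance Definition _ := GRing.Zmodule_isLmodule.Build R modquot
  modscaleA modscale1 modscaleDr modscaleDl.

Fact modclass_is_scalable : scalable modclass.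
Proof. by move=> a x; rewrite -modclassZ. Qed.

HB.instance Definition _ :=
  GRing.isScalable.Build R M modquot *:%R modclass modclass_is_scalable.

End QuotientModule.

Section TensorProduct.
Variables (R : comNzRingType) (M N : lmodType R).

Definition tensor_rel : set {malg R[(M * N)%type]} :=
  [set z | exists a m m' n,
     z = << (a *: m + m', n) >> - (a *: << (m, n) >> + << (m', n) >>)] `|`
  [set z | exists a m n n',
     z = << (m, a *: n + n') >> - (a *: << (m, n) >> + << (m, n') >>)].

Definition tensor : lmodType R := modquot tensor_rel.

Definition tens (m : M) (n : N) : tensor := modclass tensor_rel << (m, n) >>.

Lemma tens_is_linear_r m : linear (tens m).
Proof.
move=> a n n'; rewrite /tens -linearP; apply/modclassP; apply: sub_span.
by right; exists a, m, n, n'.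
Qed.

Lemma tens_is_linear_l n : linear (tens^~ n).
Proof.
move=> a m m'; rewrite /tens -linearP; apply/modclassP; apply: sub_span.
by left; exists a, m, m', n.
Qed.

End TensorProduct.

Section ExteriorPower.
Variables (R : comNzRingType) (M : lmodType R) (k : nat).

Definition ffun_set (u : {ffun 'I_k -> M}) (i : 'I_k) (m : M) : {ffun 'I_k -> M} :=
  [ffun j => if j == i then m else u j].

Definition ext_rel : set {malg R[{ffun 'I_k -> M}]} :=
  [set z | exists a u i m m',
     z = << ffun_set u i (a *: m + m') >>
         - (a *: << ffun_set u i m >> + << ffun_set u i m' >>)] `|`
  [set z | exists (u : {ffun 'I_k -> M}) i j, [/\ i != j, u i = u j & z = << u >>]].

Definition extpow : lmodType R := modquot ext_rel.

End ExteriorPower.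

Lemma malg_ind (K : nzRingType) (X : choiceType) (P : {malg K[X]} -> Prop) :
  P 0 -> (forall c x z, P z -> P (c *: << x >> + z)) -> forall z, P z.
Proof.
move=> P0 PD z; rewrite [z]monalgE; elim: (enum_fset _) => [|x s IHs].
  by rewrite big_nil.
by rewrite big_cons malgUZ; apply: PD.
Qed.

Lemma malg_bilinear_assoc (K : nzRingType) (X : choiceType) (op : X -> X -> X)
    (m : {malg K[X]} -> {malg K[X]} -> {malg K[X]}) :
  left_distributive m +%R -> right_distributive m +%R ->
  (forall c f g, m (c *: f) g = c *: m f g) ->
  (forall c f g, m f (c *: g) = c *: m f g) ->
  (forall f, m 0 f = 0) -> commutative m ->
  (forall x y, m << x >> << y >> = << op x y >>) -> associative op ->
  associative m.
Proof.
move=> mDl mDr mZl mZr m0 mC mU opA f g h.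
have m0r u : m u 0 = 0 by rewrite mC m0.
elim/malg_ind: f => [|c a f IHf]; first by rewrite !m0.
rewrite !mDl IHf !mZl; congr (_ *: _ + _).
clear IHf; elim/malg_ind: g => [|d b g IHg]; first by rewrite m0 m0r m0.
rewrite mDl !mDr mDl IHg !mZl !mZr !mZl; congr (_ *: _ + _).
clear IHg; elim/malg_ind: h => [|e x h IHh]; first by rewrite !m0r.
by rewrite !mDr IHh !mZr !mU opA.
Qed.

Lemma malg_bilinear_act (K : comNzRingType) (X : choiceType) (V : lmodType K)
    (op : X -> X -> X) (m : {malg K[X]} -> {malg K[X]} -> {malg K[X]})
    (s : {malg K[X]} -> V -> V) :
  left_distributive m +%R -> right_distributive m +%R ->
  (forall c f g, m (c *: f) g = c *: m f g) ->
  (forall c f g, m f (c *: g) = c *: m f g) ->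
  (forall f, m 0 f = 0) -> (forall f, m f 0 = 0) ->
  (forall x y, m << x >> << y >> = << op x y >>) ->
  (forall v, {morph s^~ v : f g / f + g}) -> (forall f, {morph s f : u v / u + v}) ->
  (forall c f v, s (c *: f) v = c *: s f v) ->
  (forall c f v, s f (c *: v) = c *: s f v) ->
  (forall v, s 0 v = 0) -> (forall f, s f 0 = 0) ->
  (forall x y v, s << x >> (s << y >> v) = s << op x y >> v) ->
  forall f g v, s f (s g v) = s (m f g) v.
Proof.
move=> mDl mDr mZl mZr m0 m0r mU sDl sDr sZl sZr s0 s0r sA f g v.
elim/malg_ind: f => [|c a f IHf]; first by rewrite m0 !s0.
rewrite mDl !sDl IHf mZl !sZl; congr (_ *: _ + _).
clear IHf; elim/malg_ind: g => [|d b g IHg]; first by rewrite m0r !s0 s0r.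
by rewrite mDr !sDl sDr IHg mZr !sZl sZr sA mU.
Qed.

Section GroupAlgebra.
Variables (K : comNzRingType) (A : zmodType).

(* K[A], for an abelian group A written additively: << a >> << b >> = << a + b >> *)
Definition galg : Type := {malg K[A]}.
HB.instance Definition _ := GRing.Zmodule.on galg.

Definition galg_mul (f g : galg) : galg :=
  mlift (fun a => mlift (fun b => << (a + b)%R >> : {malg K[A]}) g) f.

Fact galg_mulC : commutative galg_mul.
Proof.
move=> f g; rewrite /galg_mul /mlift.
under eq_bigr do rewrite scaler_sumr.
rewrite exchange_big /=; apply: eq_bigr => b _; rewrite scaler_sumr.
by apply: eq_bigr => a _; rewrite !scalerA mulrC addrC.
Qed.

Fact galg_mulDl : left_distributive galg_mul +%R.
Proof. by move=> f g h; rewrite /galg_mul linearD. Qed.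

Fact galg_mulDr : right_distributive galg_mul +%R.
Proof. by move=> f g h; rewrite !(galg_mulC f) galg_mulDl. Qed.

Fact galg_mulZl (c : K) (f g : {malg K[A]}) :
  galg_mul (c *: f) g = c *: (galg_mul f g : {malg K[A]}).
Proof. by rewrite /galg_mul linearZ. Qed.

Fact galg_mulZr (c : K) (f g : {malg K[A]}) :
  galg_mul f (c *: g) = c *: (galg_mul f g : {malg K[A]}).
Proof. by rewrite !(galg_mulC f) galg_mulZl. Qed.

Fact galg_mulU a b : galg_mul << a >> << b >> = << (a + b)%R >>.
Proof. by rewrite /galg_mul !mliftU. Qed.

Fact galg_mul0 f : galg_mul 0 f = 0.
Proof. by rewrite /galg_mul linear0. Qed.

Fact galg_mulA : associative galg_mul.
Proof.
exact: (malg_bilinear_assoc galg_mulDl galg_mulDr galg_mulZl galg_mulZr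
  galg_mul0 galg_mulC galg_mulU (@addrA A)).
Qed.

Fact galg_mul1 : left_id (<< 0%R >> : galg) galg_mul.
Proof.
elim/malg_ind=> [|c a f IHf]; first by rewrite galg_mulC galg_mul0.
by rewrite (galg_mulDr _ (c *: _)) IHf (galg_mulZr c _ << a >>) galg_mulU add0r.
Qed.

Fact galg_1neq0 : (<< 0%R >> : galg) != 0.
Proof. by rewrite monalgU_eq0 oner_eq0. Qed.

HB.instance Definition _ := GRing.Zmodule_isComNzRing.Build galg
  galg_mulA galg_mulC galg_mul1 galg_mulDl galg_1neq0.

Section Modules.
Variables (V : lmodType K) (act : A -> V -> V).
Hypothesis act_lin : forall a, linear (act a).
Hypothesis act0 : act 0 =1 id.
Hypothesis actD : forall a b, act (a + b) =1 act a \o act b.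

Definition galg_scale (f : galg) (v : V) : V := mlift (act^~ v) f.

Fact galg_scaleDl v : {morph galg_scale^~ v : f g / f + g}.
Proof. by move=> f g; rewrite /galg_scale linearD. Qed.

Fact galg_scale_lin f : linear (galg_scale f).
Proof.
move=> c u v; rewrite /galg_scale /mlift scaler_sumr -big_split /=.
by apply: eq_bigr => a _; rewrite act_lin scalerDr !scalerA mulrC.
Qed.

Fact galg_scaleDr : right_distributive galg_scale +%R.
Proof. by move=> f u v; have := galg_scale_lin f 1 u v; rewrite !scale1r. Qed.

Fact galg_scaleZ f c v : galg_scale f (c *: v) = c *: galg_scale f v.
Proof.
have := galg_scale_lin f c v 0; rewrite !addr0 => ->.
suff -> : galg_scale f 0 = 0 by rewrite addr0.
by have := galg_scaleDr f 0 0; rewrite addr0 => /esym/(canRL (addrK _)); rewrite subrr.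
Qed.

Fact galg_scaleU a v : galg_scale << a >> v = act a v.
Proof. exact: mliftU. Qed.

Fact galg_scale1 : left_id 1 galg_scale.
Proof. by move=> v; rewrite galg_scaleU act0. Qed.

Fact galg_scaleZl c (f : {malg K[A]}) v : galg_scale (c *: f) v = c *: galg_scale f v.
Proof. by rewrite /galg_scale linearZ. Qed.

Fact galg_scale0 v : galg_scale 0 v = 0.
Proof. by rewrite /galg_scale linear0. Qed.

Fact galg_scaler0 f : galg_scale f 0 = 0.
Proof. by have := galg_scaleZ f 0 0; rewrite !scale0r. Qed.

Fact galg_mulr0 f : galg_mul f 0 = 0.
Proof. by rewrite galg_mulC galg_mul0. Qed.

Fact galg_scaleA f g v : galg_scale f (galg_scale g v) = galg_scale (f * g) v.
Proof.
apply: (malg_bilinear_act galg_mulDl galg_mulDr galg_mulZl galg_mulZr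
  galg_mul0 galg_mulr0 galg_mulU galg_scaleDl galg_scaleDr galg_scaleZl _
  galg_scale0 galg_scaler0) => [c h u|a b u]; first exact: galg_scaleZ.
by rewrite !galg_scaleU actD.
Qed.

End Modules.

End GroupAlgebra.

Lemma tens_ind (R : comNzRingType) (M N : lmodType R) (P : tensor M N -> Prop) :
  P 0 -> (forall c m n t, P t -> P (c *: tens m n + t)) -> forall t, P t.
Proof.
move=> P0 PD; elim/modclass_ind; elim/malg_ind => [|c [m n] z Pz].
  by rewrite raddf0.
by rewrite linearP; apply: PD.
Qed.

Section TensorMap.
Variables (R : comNzRingType) (M N M' N' : lmodType R).
Variables (f : M -> M') (g : N -> N').

(* f \otimes g, for linear f and g *)
Definition tens_map (t : tensor M N) : tensor M' N' :=
  mlift (fun p => tens (f p.1) (g p.2)) (repr t).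

Hypotheses (f_lin : linear f) (g_lin : linear g).

Fact tens_map_class z :
  tens_map (modclass _ z) = mlift (fun p => tens (f p.1) (g p.2)) z.
Proof.
rewrite /tens_map; set F := mlift _; apply/eqP; rewrite -subr_eq0 -linearB.
have FL : linear F by exact: linearP.
have FB u v : F (u - v) = F u - F v by exact: linearB.
have FU p : F << p >> = tens (f p.1) (g p.2) by exact: mliftU.
apply/eqP; have /modclassP := modclass_repr (modclass (@tensor_rel R M N) z).
apply: (@span_min _ _ _ [set z | F z = 0]); first split=> [|a u v /= Fu Fv] /=.
- exact: linear0.
- by rewrite FL Fu Fv scaler0 addr0.
move=> _ [|] [a [m [m' [n ->]]]] /=; rewrite FB FL !FU /=.
  by rewrite f_lin (tens_is_linear_l (g n)) subrr.
by rewrite g_lin (tens_is_linear_r (f m)) subrr.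
Qed.

Fact tens_mapE m n : tens_map (tens m n) = tens (f m) (g n).
Proof. by rewrite /tens tens_map_class mliftU. Qed.

Fact tens_map_lin : linear tens_map.
Proof.
move=> c; elim/modclass_ind => u; elim/modclass_ind => v.
by rewrite -linearP !tens_map_class linearP.
Qed.

Fact tens_mapD : {morph tens_map : s t / s + t}.
Proof. by move=> s t; have := tens_map_lin 1 s t; rewrite !scale1r. Qed.

Fact tens_map0 : tens_map 0 = 0.
Proof. by apply: (addrI (tens_map 0)); rewrite -tens_mapD !addr0. Qed.

End TensorMap.

(* A linear map out of a tensor product is determined by its values on pure
   tensors. *)
Lemma tens_uniq (R : comNzRingType) (M N P : lmodType R) (f g : tensor M N -> P) :
  linear f -> linear g -> (forall m n, f (tens m n) = g (tens m n)) -> f =1 g.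
Proof.
move=> fl gl fg; elim/tens_ind => [|c m n t IHt]; last by rewrite fl gl fg IHt.
have l0 h : linear h -> h 0 = 0 :> P.
  move=> hl; apply: (addrI (h 0)); have := hl 1 0 0.
  by rewrite !scale1r !addr0 => <-.
by rewrite !l0.
Qed.

Section Zlinear.
Variables U V : zmodType.

Fact additive_Zlinear (f : U -> V) : {morph f : x y / x + y} ->
  linear (f : zmodule U -> zmodule V).
Proof.
move=> fD a u v; rewrite fD; congr (_ + _).
have f0 : f 0 = 0 by apply: (addrI (f 0)); rewrite -fD !addr0.
have fN x : f (- x) = - f x by apply: (addrI (f x)); rewrite -fD !subrr.
have fn x n : f (x *+ n) = f x *+ n.
  by elim: n => [//|n IHn]; rewrite !mulrS fD IHn.
rewrite !scalezrE; case: a => n; first by rewrite -!pmulrn fn.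
by rewrite NegzE -!nmulrn fN fn.
Qed.

End Zlinear.

(* B \otimes_Z K for a Z[A]-module B, first as a K-module (tensorZ), then as a
   K[A]-module (scalar_ext). *)
Section ExtensionOfScalars.
Variables (A : zmodType) (B : lmodType (galg int A)) (K : comNzRingType).

Definition tensorZ : Type := tensor (zmodule B) (zmodule K).
HB.instance Definition _ := GRing.Zmodule.on tensorZ.

Definition tensorZ_scale (c : K) : tensorZ -> tensorZ :=
  tens_map (id : zmodule B -> zmodule B) ( *%R c : zmodule K -> zmodule K).

Definition tensorZ_act (a : A) : tensorZ -> tensorZ :=
  tens_map (fun b : zmodule B => (<< a >> : galg int A) *: (b : B) : zmodule B)
    (id : zmodule K -> zmodule K).

Let idl (M : lmodType int) : linear (@id M). Proof. by []. Qed.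
Let mull (c : K) : linear ( *%R c : zmodule K -> zmodule K).
Proof. by apply: additive_Zlinear => x y; rewrite mulrDr. Qed.
Let actl (a : A) : linear
  (fun b : zmodule B => (<< a >> : galg int A) *: (b : B) : zmodule B).
Proof. by apply: additive_Zlinear => x y; rewrite scalerDr. Qed.

Fact tensorZ_scaleE c b z : tensorZ_scale c (tens b z) = tens b (c * z : zmodule K).
Proof. exact: tens_mapE. Qed.

Fact tensorZ_actE a b z : tensorZ_act a (tens b z) =
  tens ((<< a >> : galg int A) *: (b : B) : zmodule B) z.
Proof. exact: tens_mapE. Qed.

Fact tensorZ_scale_lin c : linear (tensorZ_scale c : tensor _ _ -> tensor _ _).
Proof. by apply: tens_map_lin => //; apply: mull. Qed.

Fact tensorZ_act_Zlin a : linear (tensorZ_act a : tensor _ _ -> tensor _ _).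
Proof. by apply: tens_map_lin => //; apply: actl. Qed.

Fact tensorZ_scaleDr : right_distributive tensorZ_scale +%R.
Proof. by move=> c; apply: tens_mapD => //; apply: mull. Qed.

Fact tensorZ_actD a : {morph tensorZ_act a : s t / s + t}.
Proof. by apply: tens_mapD => //; apply: actl. Qed.

Let comp_lin (U V W : lmodType int) (f : U -> V) (g : V -> W) :
  linear f -> linear g -> linear (g \o f).
Proof. by move=> fl gl a u v /=; rewrite fl gl. Qed.

Let add_lin (U V : lmodType int) (f g : U -> V) :
  linear f -> linear g -> linear (fun u => f u + g u).
Proof. by move=> fl gl a u v /=; rewrite fl gl scalerDr addrACA. Qed.

Fact tensorZ_scaleA c d t :
  tensorZ_scale c (tensorZ_scale d t) = tensorZ_scale (c * d) t.
Proof.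
apply: (@tens_uniq _ _ _ _ (tensorZ_scale c \o tensorZ_scale d)).
- by apply: comp_lin; apply: tensorZ_scale_lin.
- exact: tensorZ_scale_lin.
by move=> b z /=; rewrite !tensorZ_scaleE mulrA.
Qed.

Fact tensorZ_scale1 : left_id 1 tensorZ_scale.
Proof.
apply: tens_uniq => //; first exact: tensorZ_scale_lin.
by move=> b z; rewrite tensorZ_scaleE mul1r.
Qed.

Fact tensorZ_scaleDl t : {morph tensorZ_scale^~ t : c d / c + d}.
Proof.
move=> c d.
apply: (@tens_uniq _ _ _ _ _ (fun t => tensorZ_scale c t + tensorZ_scale d t)).
- exact: tensorZ_scale_lin.
- by apply: add_lin; apply: tensorZ_scale_lin.
move=> b z; rewrite !tensorZ_scaleE mulrDl.
by have := tens_is_linear_r (b : zmodule B) 1 (c * z : zmodule K) (d * z);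
   rewrite !scale1r.
Qed.

Fact tensorZ_act_scale a c t :
  tensorZ_act a (tensorZ_scale c t) = tensorZ_scale c (tensorZ_act a t).
Proof.
apply: (@tens_uniq _ _ _ _ (tensorZ_act a \o tensorZ_scale c)
                           (tensorZ_scale c \o tensorZ_act a)).
- by apply: comp_lin; [exact: tensorZ_scale_lin|exact: tensorZ_act_Zlin].
- by apply: comp_lin; [exact: tensorZ_act_Zlin|exact: tensorZ_scale_lin].
by move=> b z /=; rewrite tensorZ_scaleE !tensorZ_actE tensorZ_scaleE.
Qed.

HB.instance Definition _ := GRing.Zmodule_isLmodule.Build K tensorZ
  tensorZ_scaleA tensorZ_scale1 tensorZ_scaleDr tensorZ_scaleDl.

Fact tensorZ_act_lin a : linear (tensorZ_act a).
Proof.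
by move=> c s t; apply: etrans (tensorZ_actD _ _ _) _; rewrite tensorZ_act_scale.
Qed.

Fact tensorZ_act0 : tensorZ_act 0 =1 id.
Proof.
apply: tens_uniq => //; first exact: tensorZ_act_Zlin.
by move=> b z; rewrite tensorZ_actE scale1r.
Qed.

Fact tensorZ_actA a b : tensorZ_act (a + b) =1 tensorZ_act a \o tensorZ_act b.
Proof.
apply: tens_uniq; first exact: tensorZ_act_Zlin.
  by apply: comp_lin; apply: tensorZ_act_Zlin.
move=> x z; rewrite [LHS]tensorZ_actE; apply: esym.
apply: etrans (congr1 (tensorZ_act a) (tensorZ_actE b x z)) _.
apply: etrans (tensorZ_actE _ _ _) _.
have E : (<< a >> : galg int A) *: ((<< b >> : galg int A) *: (x : B)) =
         (<< (a + b)%R >> : galg int A) *: (x : B).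
  by rewrite scalerA; congr (_ *: _); apply: galg_mulU.
exact (f_equal (fun y : zmodule B => tens y z) E).
Qed.

Definition scalar_ext : Type := tensorZ.
HB.instance Definition _ := GRing.Zmodule.on scalar_ext.
HB.instance Definition _ := GRing.Zmodule_isLmodule.Build (galg K A) scalar_ext
  (galg_scaleA tensorZ_act_lin tensorZ_actA) (galg_scale1 tensorZ_act0)
  (galg_scaleDr tensorZ_act_lin) (galg_scaleDl tensorZ_act).

Lemma scalar_extE (a : A) (b : B) (z : K) :
  (<< a >> : galg K A) *: (tens (b : zmodule B) (z : zmodule K) : scalar_ext) =
  tens ((<< a >> : galg int A) *: b : zmodule B) (z : zmodule K).
Proof. exact: etrans (galg_scaleU _ _ _) (tensorZ_actE _ _ _). Qed.

Lemma scalar_ext_constE (c : K) (b : B) (z : K) :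
  (c *: (<< 0%R >> : {malg K[A]}) : galg K A) *:
    (tens (b : zmodule B) (z : zmodule K) : scalar_ext) =
  tens (b : zmodule B) (c * z : zmodule K).
Proof.
rewrite -[LHS]/(galg_scale tensorZ_act _ _) galg_scaleZl.
rewrite galg_scaleU tensorZ_act0; exact: tensorZ_scaleE.
Qed.

End ExtensionOfScalars.

Section RationalAlexanderInvariant.
Variable G : groupType.

Let conjZ (a : Gabf G) : zmodule (BQ G) -> zmodule (BQ G) := conjBQ a.

Fact conjBQ_Zlin a : linear (conjZ a).
Proof. exact: additive_Zlinear (@conjBQD G a). Qed.

HB.instance Definition _ :=
  GRing.Zmodule_isLmodule.Build (galg int (Gabf G)) (BQ G)
    (galg_scaleA conjBQ_Zlin (@conjBQA G)) (galg_scale1 (@conjBQ0 G : conjZ 0 =1 id))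
    (galg_scaleDr conjBQ_Zlin) (galg_scaleDl conjZ).

Lemma BQ_scaleE (g : G) (x : GQ1_type G) :
  (<< abclass (GQ1_kernel G) g : Gabf G >> : galg int (Gabf G)) *:
    (abclass (GQ2_kernel G) x : BQ G) = abclass (GQ2_kernel G) (conjGQ1 g x).
Proof.
by rewrite -[LHS]/(galg_scale conjZ _ _) galg_scaleU; exact: conjBQ_class.
Qed.

End RationalAlexanderInvariant.

Section Support.
Variables (R : comNzRingType) (M : lmodType R).
Implicit Types I m : set R.

Definition is_ideal I : Prop :=
  [/\ I 0, forall x y, I x -> I y -> I (x + y) & forall a x, I x -> I (a * x)].

Definition maximal_ideal m : Prop :=
  [/\ is_ideal m, ~ m 1 & forall I, is_ideal I -> m `<=` I -> I = m \/ I = setT].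

(* The fraction x / s of the localization M_m is the pair (x, s), s \notin m. *)
Definition fraction_eq m (p q : M * R) : Prop :=
  exists2 u, ~ m u & u *: (q.2 *: p.1 - p.2 *: q.1) = 0.

Definition localization_neq0 m : Prop :=
  exists2 p : M * R, ~ m p.2 & ~ fraction_eq m p (0, 1).

Definition module_support : set (set R) :=
  [set m | maximal_ideal m /\ localization_neq0 m].

End Support.

(* H_1(G, K_rho) is the first homology of K_rho \otimes_{K[G]} Bar(G), where
   Bar(G) is the bar resolution by free left modules and K_rho is K with the
   right action x . g = rho(g) x. Turning K_rho into a left module first, by
   g . x = rho(g) x, would replace rho by rho^-1; this choice is the one that is
   compatible with the action of g on B_Q(G) by x |-> g x g^-1. *)
Section GroupHomology.
Variables (G : groupType) (K : fieldType) (rho : G -> K).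

Definition chain1 : Type := {malg K[G]}.
HB.instance Definition _ := GRing.Lmodule.on chain1.
Definition chain2 : Type := {malg K[(G * G)%type]}.
HB.instance Definition _ := GRing.Lmodule.on chain2.

Definition bar1 : chain1 -> K^o := mlift (fun g => rho g - 1 : K^o).

Definition bar2 : chain2 -> chain1 :=
  mlift (fun gh => rho gh.1 *: << gh.2 >> - << (gh.1 * gh.2)%g >> + << gh.1 >>
                   : {malg K[G]}).

Definition cycle1_pred : {pred chain1} := fun z => bar1 z == 0.

Fact cycle1_closed : submod_closed cycle1_pred.
Proof.
split=> [|c u v /eqP zu /eqP zv]; apply/eqP; first exact: linear0.
have -> : bar1 (c *: u + v) = c *: bar1 u + bar1 v by exact: linearP.
by rewrite zu zv scaler0 addr0.
Qed.
HB.instance Definition _ := GRing.isSubmodClosed.Build K chain1 cycle1_pred cycle1_closed.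

Definition cycle1 : Type := {z : chain1 | z \in cycle1_pred}.
HB.instance Definition _ := SubChoice.on cycle1.
HB.instance Definition _ := [SubChoice_isSubLmodule of cycle1 by <:].

Definition H1 : lmodType K :=
  modquot [set z : cycle1 | exists c, val z = bar2 c].

End GroupHomology.

Definition dim_ge (K : fieldType) (V : lmodType K) (k : nat) : Prop :=
  exists v : 'I_k -> V,
    forall c : 'I_k -> K, \sum_i c i *: v i = 0 -> forall i, c i = 0.

Section CharacteristicVarieties.
Variables (C : numClosedFieldType) (G : groupType).

Definition character_group : set (G -> C) :=
  [set rho | (forall g, rho g != 0) /\ {morph rho : g h / (g * h)%g >-> g * h}].

(* The identity component, for the topology of pointwise convergence; when G is
   generated by n elements this is the topology of T_G as a subset of (C^* )^n. *)
Definition character_group0 : set (G -> C) :=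
  @connected_component {ptws G -> C} character_group (fun=> 1).

Definition Vk (k : nat) : set (G -> C) :=
  [set rho | character_group rho /\ dim_ge (H1 rho) k].

Definition Wk (k : nat) : set (G -> C) := Vk k `&` character_group0.

Definition abf_character (chi : Gabf G -> C) : Prop :=
  (forall a, chi a != 0) /\ {morph chi : a b / a + b >-> a * b}.

Definition abf_eval (chi : Gabf G -> C) (f : galg C (Gabf G)) : C :=
  mlift (chi : Gabf G -> C^o) f.

(* The points of the support of M, as elements of T_G^0: a character chi of
   G_abf is identified with its pullback to G, and with the kernel of the
   evaluation f |-> f(chi) on C[G_abf]. *)
Definition support_T0 (M : lmodType (galg C (Gabf G))) : set (G -> C) :=
  [set rho | exists chi, [/\ abf_character chi, rho = chi \o abclass (GQ1_kernel G)
     & module_support M [set f | abf_eval chi f = 0]]].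

End CharacteristicVarieties.

Arguments character_group C G : clear implicits.
Arguments character_group0 C G : clear implicits.
Arguments Vk C G k : clear implicits.
Arguments Wk C G k : clear implicits.

(* Main.v *)
From HB Require Import structures.
From mathcomp Require Import all_boot all_order all_algebra.
From mathcomp Require Import finmap monalg complex zify.
From mathcomp Require Import boolp classical_sets reals topology normedtype.
Require Import Defs.
Set Implicit Arguments.
Unset Strict Implicit.
Unset Printing Implicit Defensive.
Import Order.TTheory GRing.Theory Num.Theory.
Import numFieldNormedType.Exports.
Local Open Scope classical_set_scope.
Local Open Scope ring_scope.

(** Write A for G_abf, M for the C[A]-module B_Q(G) (x) C, and, for a character
    chi of A, ev : C[A] -> C for the evaluation at chi and m for its kernel.

    The component T^0_G consists of the characters of G that factor through A.
    At a given element of G'_Q all characters take values in the m-th roots of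
    unity for one m, so those in a connected set of characters containing 1 take
    the value 1 (character_group0_GQ1). Conversely A is free of finite rank, so
    a character of A is given by the nonzero complex numbers that it takes on a
    basis, and each of these can be joined to 1 inside C^*
    (character_group0_abf).

    Let rho be the pullback to G of a character chi <> 1. Then
    H_1(G, C_rho) = M / m M. Modulo boundaries, the class [g] of the 1-chain g
    satisfies [g h] = [g] + rho(g) [h]; it is therefore additive on G'_Q, kills
    G''_Q because C is torsion free, and turns conjugation by g into
    multiplication by rho(g). This gives an ev-semilinear map M -> H_1
    (alexander_to_H1). Fix g0 with rho(g0) <> 1. Expanding [g g0] in two ways
    expresses [g] by the class of the commutator of g^-1 and g0^-1 and by [g0],
    so that the map is surjective (alexander_to_H1_surj). The same formula, read
    as a definition, sends a chain g to a multiple of that commutator in M; it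
    takes boundaries into m M, and it inverts the first map modulo m M
    (alexander_to_H1_ker).

    What is left is commutative algebra: M is finitely generated
    (alex_finitely_generated), and for a finitely generated module the k-th
    exterior power is nonzero at m exactly when dim M / m M >= k
    (localized_extpow_neq0). If the dimension d is less than k, Nakayama's lemma
    yields u outside m such that u M lies in the span of d elements, and u^k
    annihilates the exterior power. If k <= d, the determinant of k coordinates
    on M / m M is an alternating form that detects a nonzero element. *)

(** * Finite-dimensional linear algebra *)

Definition spanning (R : nzRingType) (V : lmodType R) n (x : 'I_n -> V) : Prop :=
  forall y, exists c : 'I_n -> R, y = \sum_i c i *: x i.

Section LinearAlgebra.
Variables (K : fieldType) (V : lmodType K).

Lemma dim_ge_spanning n (x : 'I_n -> V) k :
  spanning x -> dim_ge V k -> (k <= n)%N.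
Proof.
move=> xs [v vfree]; rewrite leqNgt; apply/negP => nk.
have [A vA] := choice (fun i => xs (v i)).
pose B := \matrix_(i, j) A i j.
have [|] := boolP (row_free B).
  by rewrite /row_free => /eqP rk; have := rank_leq_col B; rewrite rk leqNgt nk.
rewrite -kermx_eq0 => /rowV0Pn[u /sub_kermxP uB0 /rV0Pn[i ui]].
case/eqP: ui; apply: (vfree (fun i => u 0 i)).
under eq_bigr do rewrite vA scaler_sumr.
rewrite exchange_big big1 // => j _; under eq_bigr do rewrite scalerA.
rewrite -scaler_suml; have /matrixP/(_ 0 j) := uB0; rewrite !mxE => e.
by rewrite (_ : \sum_i _ = 0) ?scale0r // -[RHS]e; apply: eq_bigr => l _; rewrite mxE.
Qed.

Lemma dim_ge_leq k d : (k <= d)%N -> dim_ge V d -> dim_ge V k.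
Proof.
move=> kd [v vfree]; exists (fun i => v (widen_ord kd i)) => c c0 i.
pose e (j : 'I_d) := if insub (val j) is Some l then c l else 0.
have ew l : e (widen_ord kd l) = c l by rewrite /e /= valK.
rewrite -ew; apply: vfree; rewrite -[RHS]c0.
rewrite (bigID (fun j : 'I_d => (j < k)%N)) /= [X in _ + X]big1 ?addr0.
  rewrite (big_ord_narrow kd) /=.
  by apply: eq_bigr => l _; rewrite ew.
by move=> j jk; rewrite /e insubN // scale0r.
Qed.

(** A space with a finite spanning family has a largest free family, and such a
    family spans; the coordinates in it are kept as plain functions. *)
Lemma coordinates_of_spanning n (x : 'I_n -> V) : spanning x ->
  exists d (v : 'I_d -> V) (coord : 'I_d -> V -> K),
    [/\ forall k, dim_ge V k <-> (k <= d)%N,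
        forall y, y = \sum_i coord i y *: v i,
        forall i a y z, coord i (a *: y + z) = a * coord i y + coord i z
      & forall i j, coord i (v j) = (i == j)%:R].
Proof.
move=> xs; pose P d := `[< dim_ge V d >].
have exP : exists d, P d by exists 0%N; apply/asboolP; exists (fun _ => 0) => c _ [].
have ubP d : P d -> (d <= n)%N by move=> /asboolP; apply: dim_ge_spanning xs.
have [d /asboolP dimd dmax] := ex_maxnP exP ubP.
have [v vfree] := dimd.
have vs : spanning v.
  move=> y; apply: contrapT => ny.
  suff /asboolT/dmax : dim_ge V d.+1 by rewrite ltnn.
  (* A vector y outside the span of v extends v by one more free vector. *)
  exists (fun i => oapp v y (unlift ord_max i)) => c.
  rewrite big_ord_recr /= unlift_none /=.
  under eq_bigr => i _.
    have -> : widen_ord (leqnSn d) i = lift ord_max i.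
      by apply/val_inj; rewrite /= /bump leqNgt ltn_ord.
    rewrite liftK /=; over.
  move=> c0; have [cm|cm] := eqVneq (c ord_max) 0.
    move: c0; rewrite cm scale0r addr0 => /vfree ci i.
    by case: (unliftP ord_max i) => [j|] ->.
  case: ny; exists (fun i => - (c ord_max)^-1 * c (lift ord_max i)).
  under eq_bigr do rewrite -scalerA.
  rewrite -scaler_sumr; move/eqP: c0; rewrite addrC addr_eq0 => /eqP c0.
  by rewrite scaleNr -scalerN -c0 scalerA mulVf // scale1r.
have [coord ve] := choice vs.
have cu y c : y = \sum_i c i *: v i -> forall i, coord y i = c i.
  move=> e i; apply/eqP; rewrite -subr_eq0; apply/eqP; move: i; apply: vfree.
  under eq_bigr do rewrite scalerBl.
  by rewrite sumrB -ve -e subrr.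
exists d, v, (fun i y => coord y i); split=> //.
- move=> k; split; last by move=> kd; apply: dim_ge_leq kd dimd.
  by move/asboolT/dmax.
- move=> i a y z; apply: (cu _ (fun i => a * coord y i + coord z i)).
  rewrite {1}(ve y) {1}(ve z) scaler_sumr -big_split; apply: eq_bigr => j _.
  by rewrite scalerDl scalerA.
move=> i j; apply: (cu _ (fun i => (i == j)%:R)).
rewrite (bigD1 j) //= eqxx scale1r big1 ?addr0 // => l /negPf ->.
by rewrite scale0r.
Qed.

End LinearAlgebra.

(** * Localization of exterior powers *)

Section Nakayama.
Variables (R : comNzRingType) (K : fieldType) (ev : {rmorphism R -> K}).
Variable M : lmodType R.

(** The determinant trick: x is congruent to C x modulo N for a matrix C with
    entries in the kernel of ev, so the determinant of 1 - C, which evaluates to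
    1, carries every x a into N. *)
Lemma nakayama (N : set M) n (x : 'I_n -> M) : submodule N ->
  (forall a, exists c : 'I_n -> R,
     (forall b, ev (c b) = 0) /\ N (x a - \sum_b c b *: x b)) ->
  exists2 u, ev u = 1 & forall a, N (u *: x a).
Proof.
move=> [N0 Na] /choice[c /all_and2[c0 Nc]].
have Nsum m (r : 'I_m -> R) y : (forall i, N (y i)) -> N (\sum_i r i *: y i).
  move=> Ny; elim/big_ind: _ => // [u v Nu Nv|i _]; first by rewrite -[u]scale1r; apply: Na.
  by rewrite -[_ *: _]addr0; apply: Na.
pose D : 'M[R]_n := 1%:M - \matrix_(a, b) c a b.
exists (\det D) => [|a].
  rewrite -det_map_mx (_ : map_mx ev D = 1%:M) ?det1 //.
  by apply/matrixP=> i j; rewrite !mxE rmorphB /= c0 subr0 rmorph_nat.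
suff -> : \det D *: x a = \sum_b (\adj D a b) *: (x b - \sum_l c b l *: x l) by apply: Nsum.
have DE b : x b - \sum_l c b l *: x l = \sum_l D b l *: x l.
  under [RHS]eq_bigr do rewrite !mxE scalerBl.
  rewrite sumrB; congr (_ - _).
  rewrite (bigD1 b) //= eqxx scale1r big1 ?addr0 // => l.
  by rewrite eq_sym => /negPf->; rewrite scale0r.
under [RHS]eq_bigr do rewrite DE scaler_sumr.
rewrite exchange_big /=.
under [RHS]eq_bigr => l _.
  under eq_bigr do rewrite scalerA.
  rewrite -scaler_suml (_ : \sum_i _ = \det D *+ (a == l)); last first.
    by have /matrixP/(_ a l) := mul_adj_mx D; rewrite !mxE.
  over.
rewrite (bigD1 a) //= eqxx big1 ?addr0 // => l.
by rewrite eq_sym => /negPf->; rewrite scale0r.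
Qed.

End Nakayama.

Section Wedge.
Variables (R : comNzRingType) (M : lmodType R) (k : nat).

Definition wedge (w : {ffun 'I_k -> M}) : extpow M k := modclass (@ext_rel R M k) << w >>.

Lemma wedge_linear w i : linear (fun m => wedge (ffun_set w i m)).
Proof.
move=> a m m'; rewrite /wedge -linearP; apply/modclassP; apply: sub_span.
by left; exists a, w, i, m, m'.
Qed.

Lemma wedge_repeat (w : {ffun 'I_k -> M}) i j : i != j -> w i = w j -> wedge w = 0.
Proof.
by move=> ij wij; apply/modclass_eq0; apply: sub_span; right; exists w, i, j.
Qed.

Lemma wedge_ind (P : extpow M k -> Prop) :
  P 0 -> (forall c w t, P t -> P (c *: wedge w + t)) -> forall t, P t.
Proof.
move=> P0 PD; elim/modclass_ind; elim/malg_ind => [|c w z Pz].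
  by rewrite raddf0.
by rewrite linearP; apply: PD.
Qed.

Lemma ffun_set_id (w : {ffun 'I_k -> M}) i : ffun_set w i (w i) = w.
Proof. by apply/ffunP=> j; rewrite ffunE; case: eqP => [->|]. Qed.

(** Each of the k factors of a decomposable element can absorb one factor u and
    is then a combination of the y i. Multilinearity leaves products of k of the
    d < k elements y i, and these repeat a factor. *)
Lemma wedge_annihilated d (y : 'I_d -> M) (u : R) : (d < k)%N ->
  (forall m, exists c : 'I_d -> R, u *: m = \sum_i c i *: y i) ->
  forall t : extpow M k, u ^+ k *: t = 0.
Proof.
move=> dk uM.
suff uW w : u ^+ k *: wedge w = 0.
  elim/wedge_ind => [|c w t t0]; first by rewrite scaler0.
  by rewrite scalerDr t0 addr0 scalerA mulrC -scalerA uW scaler0.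
(* Induction on the number j of factors that are not yet among the y i. *)
suff H j : (j <= k)%N -> forall w : {ffun 'I_k -> M},
    (forall i : 'I_k, (j <= i)%N -> exists l, w i = y l) -> u ^+ j *: wedge w = 0.
  by apply: H => // i; rewrite leqNgt ltn_ord.
elim: j => [_|j IHj jk] {}w wy.
  have [f wf] := choice (fun i => wy i (leq0n i)).
  have /injectivePn[i [j ij fij]] : ~~ injectiveb f.
    by apply/negP => /injectiveP/leq_card; rewrite !card_ord leqNgt dk.
  by rewrite (wedge_repeat ij) ?scaler0 // !wf fij.
pose i := Ordinal jk; have [c uc] := uM (w i).
pose L m := wedge (ffun_set w i m).
pose hL : {linear M -> extpow M k} := HB.pack L (GRing.isLinear.Build _ _ _ _ L (wedge_linear w i)).
have -> : u ^+ j.+1 *: wedge w = u ^+ j *: hL (u *: w i).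
  by rewrite linearZ /= /L ffun_set_id scalerA exprSr.
rewrite uc linear_sum scaler_sumr big1 // => l _.
rewrite linearZ /= scalerA mulrC -scalerA IHj ?scaler0 //; first exact: ltnW.
move=> b jb; rewrite /L ffunE; case: eqP => [_|/eqP bi]; first by exists l.
apply: wy; rewrite ltn_neqAle jb andbT; apply: contraNneq bi => jb'.
exact/eqP/val_inj.
Qed.

End Wedge.

(** The R-module structure of K through ev, which makes an ev-semilinear form an
    R-linear map, so that it can be defined on a free R-module by its values. *)
Definition evmod (R : nzRingType) (K : nzRingType) (ev : {rmorphism R -> K}) : Type := K.

Section EvaluationModule.
Variables (R K : nzRingType) (ev : {rmorphism R -> K}).
HB.instance Definition _ := GRing.Zmodule.on (evmod ev).

Definition evscale (a : R) (x : evmod ev) : evmod ev := ev a * (x : K).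
Fact evscaleA a b x : evscale a (evscale b x) = evscale (a * b) x.
Proof. by rewrite /evscale rmorphM mulrA. Qed.
Fact evscale1 : left_id 1 evscale.
Proof. by move=> x; rewrite /evscale rmorph1 mul1r. Qed.
Fact evscaleDr : right_distributive evscale +%R.
Proof. by move=> a x y; apply: mulrDr. Qed.
Fact evscaleDl x : {morph evscale^~ x : a b / a + b}.
Proof. by move=> a b; rewrite /evscale rmorphD; apply: mulrDl. Qed.
HB.instance Definition _ := GRing.Zmodule_isLmodule.Build R (evmod ev)
  evscaleA evscale1 evscaleDr evscaleDl.

Lemma evmodZE a (x : evmod ev) : a *: x = ev a * (x : K) :> K.
Proof. by []. Qed.
End EvaluationModule.

Section ExteriorSupport.
Variables (R : comNzRingType) (K : fieldType) (ev : {rmorphism R -> K}).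
Variables (M : lmodType R) (V : lmodType K) (phi : M -> V).
Hypothesis ev_surj : forall c, exists r, ev r = c.
Hypothesis phiP : forall r x y, phi (r *: x + y) = ev r *: phi x + phi y.
Hypothesis phi_surj : forall v, exists x, phi x = v.
Hypothesis phi_ker : forall x, phi x = 0 ->
  submod_span [set y | exists2 r, ev r = 0 & exists z, y = r *: z] x.

Let phi0 : phi 0 = 0.
Proof. by have := phiP (-1) 0 0; rewrite scaler0 addr0 rmorphN rmorph1 scaleN1r addNr. Qed.

Let phi_sum n (c : 'I_n -> R) x :
  phi (\sum_i c i *: x i) = \sum_i ev (c i) *: phi (x i).
Proof.
by elim/big_rec2: _ => [|i y v _ <-]; rewrite ?phi0 ?phiP.
Qed.

Definition combinations n (I : set R) (y : 'I_n -> M) : set M :=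
  [set x | exists2 c : 'I_n -> R, (forall i, I (c i)) & x = \sum_i c i *: y i].

Lemma combinations_submodule n (y : 'I_n -> M) (I : set R) :
  I 0 -> (forall a c e, I c -> I e -> I (a * c + e)) ->
  submodule (combinations I y).
Proof.
move=> I0 ID; split=> [|a _ _ [c Ic ->] [e Ie ->]].
  by exists (fun _ => 0); rewrite // big1 // => i _; rewrite scale0r.
exists (fun i => a * c i + e i) => [i|]; first exact: ID.
rewrite scaler_sumr -big_split /=.
by apply: eq_bigr => i _; rewrite scalerDl scalerA.
Qed.

(** Here V is the fibre M / ker ev M, given through a surjection phi with that
    kernel. A fraction of the localization vanishes when some u with ev u != 0
    kills its numerator. *)
Lemma localized_extpow_neq0 n (x : 'I_n -> M) k : spanning x ->
  localization_neq0 (extpow M k) [set r | ev r = 0] <-> dim_ge V k.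
Proof.
move=> xs.
have phixs : spanning (fun i => phi (x i)).
  move=> v; have [y <-] := phi_surj v; have [c ->] := xs y.
  by exists (fun i => ev (c i)); rewrite phi_sum.
have [d [v [coord [dimP vE coordP coordv]]]] := coordinates_of_spanning phixs.
have [y phiy] := choice (fun i => phi_surj (v i)).
rewrite dimP; split=> [[p p2 pneq0]|kd].
  rewrite leqNgt; apply/negP => dk; apply: pneq0.
  have sN := combinations_submodule y (I := setT) I (fun _ _ _ _ _ => I).
  have [u u1 uN] : exists2 u, ev u = 1 & forall a, combinations setT y (u *: x a).
    (* The lifts y i of a basis of V generate M modulo ker ev M. *)
    apply: nakayama => // a.
    have [r rE] := choice (fun i => ev_surj (coord i (phi (x a)))).
    have : phi ((-1) *: (\sum_i r i *: y i) + x a) = 0.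
      rewrite phiP rmorphN rmorph1 scaleN1r phi_sum.
      by under eq_bigr do rewrite rE phiy; rewrite -vE addNr.
    move/phi_ker; rewrite scaleN1r => kx.
    have [c ec xE] : combinations [set r | ev r = 0] x (- (\sum_i r i *: y i) + x a).
      move: kx; apply: span_min.
        apply: (@combinations_submodule _ _ [set r | ev r = 0]); first exact: rmorph0.
        by move=> s s' s'' /= s0 s1; rewrite rmorphD rmorphM s0 s1 mulr0 addr0.
      move=> _ [s s0 [z ->]]; have [c ->] := xs z.
      exists (fun i => s * c i) => [i|]; first by rewrite /= rmorphM s0 mul0r.
      by rewrite scaler_sumr; under eq_bigr do rewrite scalerA.
    exists c; split=> //; exists r => //.
    by rewrite -xE opprD opprK addrCA subrr addr0.
  exists (u ^+ k); first by rewrite /= rmorphXn u1 expr1n; apply/eqP/oner_neq0.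
  apply: (wedge_annihilated (y := y) dk) => m; have [c ->] := xs m.
  suff : combinations setT y (u *: (\sum_i c i *: x i)) by case=> e _; exists e.
  rewrite scaler_sumr; elim/big_ind: _ => [|s t Ns Nt|i _]; first by case: sN.
    by case: sN => _ sN; rewrite -[s]scale1r; apply: sN.
  case: sN => N0 sN; rewrite scalerA mulrC -scalerA -[_ *: _]addr0.
  exact: sN.
(* The alternating form: the minor of the first k coordinates of the images in V. *)
pose D (w : {ffun 'I_k -> M}) : evmod ev :=
  \det (\matrix_(i, j) coord (widen_ord kd j) (phi (w i))).
pose Dl : {malg R[{ffun 'I_k -> M}]} -> evmod ev := mlift D.
have DlU w : Dl << w >> = D w by exact: mliftU.
have DlP a s t : Dl (a *: s + t) = a *: Dl s + Dl t by exact: linearP.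
have DlB s t : Dl (s - t) = Dl s - Dl t by exact: linearB.
have Dl_rel : submod_span (@ext_rel R M k) `<=` [set z | Dl z = 0].
  apply: span_min; first split=> [|a s t /= s0 t0]; first exact: linear0.
    by rewrite DlP s0 t0 scaler0 addr0.
  move=> _ [[a [w [i [m [m' ->]]]]]|[w [i [j [ij wij ->]]]]] /=; last first.
    rewrite DlU.
    by apply: (determinant_alternate ij) => l; rewrite !mxE wij.
  rewrite DlB DlP !DlU; apply/eqP; rewrite subr_eq0; apply/eqP.
  have DP : D (ffun_set w i (a *: m + m')) =
      ev a * (D (ffun_set w i m) : K) + 1 * (D (ffun_set w i m') : K) :> K.
    apply: (@determinant_multilinear _ _ _ _ _ i).
    - by rewrite scale1r; apply/rowP=> j; rewrite !mxE !ffunE eqxx phiP coordP.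
    - by apply/matrixP=> j l; rewrite !mxE !ffunE eq_sym (negPf (neq_lift _ _)).
    - by apply/matrixP=> j l; rewrite !mxE !ffunE eq_sym (negPf (neq_lift _ _)).
  by rewrite DP mul1r.
exists (wedge [ffun i => y (widen_ord kd i)], 1) => /=.
  by rewrite rmorph1; apply/eqP/oner_neq0.
case=> u /= u0; rewrite scaler0 subr0 scale1r -linearZ => /modclass_eq0/Dl_rel /=.
have DlZ a s : Dl (a *: s) = a *: Dl s by exact: linearZ.
rewrite DlZ DlU evmodZE (_ : D _ = 1) ?mulr1 //.
rewrite /D [X in \det X](_ : _ = 1%:M) ?det1 //; apply/matrixP=> i j.
by rewrite !mxE ffunE phiy coordv eq_sym.
Qed.
End ExteriorSupport.

(** * Characters as points of the group algebra *)

Section Evaluation.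
Variables (C : numClosedFieldType) (G : groupType) (chi : Gabf G -> C).
Hypothesis chiP : abf_character chi.

Lemma abf_character0 : chi 0 = 1.
Proof.
case: chiP => chi_neq0 chiD; apply: (mulfI (chi_neq0 0)).
by rewrite -chiD addr0 mulr1.
Qed.

Lemma abf_evalU a : abf_eval chi << a >> = chi a.
Proof. exact: (@mliftU C (Gabf G) C^o chi a). Qed.

Lemma abf_eval_linear (c : C) (f g : {malg C[Gabf G]}) :
  abf_eval chi (c *: f + g) = c * abf_eval chi f + abf_eval chi g.
Proof. exact: (@mlift_is_linear C (Gabf G) C^o chi). Qed.

Fact abf_eval_additive : zmod_morphism (abf_eval chi).
Proof. by move=> f g; apply: (linearB (mlift (chi : Gabf G -> C^o))). Qed.

Fact abf_eval_monoid : monoid_morphism (abf_eval chi).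
Proof.
split=> [|f g]; first by rewrite -abf_character0; apply: abf_evalU.
have [_ chiD] := chiP.
have ev0 : abf_eval chi 0 = 0 by apply: (linear0 (mlift (chi : Gabf G -> C^o))).
change (abf_eval chi (galg_mul f g) = abf_eval chi f * abf_eval chi g).
elim/malg_ind: f => [|c a f IHf]; first by rewrite galg_mul0 ev0 mul0r.
rewrite galg_mulDl galg_mulZl !abf_eval_linear IHf mulrDl.
congr (_ + _); rewrite -mulrA; congr (_ * _); clear IHf.
elim/malg_ind: g => [|d b g IHg]; first by rewrite galg_mulr0 ev0 mulr0.
by rewrite galg_mulDr galg_mulZr galg_mulU !abf_eval_linear IHg !abf_evalU mulrDr chiD mulrCA.
Qed.

Definition abf_ev : {rmorphism galg C (Gabf G) -> C} :=
  HB.pack (abf_eval chi)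
    (GRing.isZmodMorphism.Build _ _ _ abf_eval_additive)
    (GRing.isMonoidMorphism.Build _ _ _ abf_eval_monoid).

Lemma abf_ev_const (c : C) : abf_ev (c *: << 0 >> : {malg C[Gabf G]}) = c.
Proof.
have := abf_eval_linear c << 0 >> 0; rewrite addr0 abf_evalU abf_character0 mulr1.
by rewrite /abf_eval linear0 addr0.
Qed.

End Evaluation.

Lemma ker_maximal (R : comNzRingType) (K : fieldType) (ev : {rmorphism R -> K}) :
  (forall c, exists r, ev r = c) -> maximal_ideal [set r | ev r = 0].
Proof.
move=> ev_surj; split=> [||I [I0 ID IM] kerI].
- split=> [|x y /= x0 y0|a x /= x0]; first exact: rmorph0.
    by rewrite rmorphD x0 y0 addr0.
  by rewrite rmorphM x0 mulr0.
- by rewrite /= rmorph1; apply/eqP/oner_neq0.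
have [IK|/existsNP[x /not_implyP[Ix xK]]] := pselect (I `<=` [set r | ev r = 0]).
  by left; apply/seteqP.
right; apply/seteqP; split=> // y _.
have [z zE] := ev_surj (ev x)^-1.
have I1 : I 1.
  rewrite -(subrK (z * x) 1); apply: ID; last exact: IM.
  by apply: kerI; rewrite /= rmorphB rmorph1 rmorphM zE mulVf ?subrr //; apply/eqP.
by rewrite -[y]mulr1; apply: IM.
Qed.

(** * Finite generation of the Alexander module *)

Section CommutatorsOfGenerators.
Local Open Scope group_scope.

Lemma commMgJ (G : groupType) (x y z : G) : [~ x * y, z] = [~ x, z] ^ y * [~ y, z].
Proof. by rewrite !commgEl conjgE conjMg invgM -!mulgA !mulVKg. Qed.

Variables (G : groupType) (H : set G).
Hypotheses (H_sub : subgroup H) (H_normal : forall x g, H x -> H (x ^ g)).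

Let comm_subgroup b : subgroup [set x | H [~ x, b]].
Proof.
case: H_sub => H1 HM HV; split=> [|x y /= Hx Hy|x /= Hx]; first by rewrite /= comm1g.
  by rewrite commMgJ; apply: HM => //; apply: H_normal.
suff -> : [~ x^-1, b] = ([~ x, b] ^ x^-1)^-1 by apply: HV; apply: H_normal.
by apply: (mulgI ([~ x, b] ^ x^-1)); rewrite -commMgJ !mulgV comm1g.
Qed.

(** For a fixed b, the elements commuting with b modulo the normal subgroup H form
    a subgroup; apply this twice, once for each argument of the commutator. *)
Lemma comm_generated (S : set G) : generated S = setT ->
  (forall a b, S a -> S b -> H [~ a, b]) -> forall x y, H [~ x, y].
Proof.
move=> S_gen HS; case: (H_sub) => _ _ HV.
have H1 x b : S b -> H [~ x, b].
  move=> Sb; have : generated S x by rewrite S_gen.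
  by move/(_ [set z | H [~ z, b]]); apply; split; [apply: comm_subgroup | move=> a Sa; apply: HS].
move=> x y; rewrite -invgR; apply: (HV).
have : generated S y by rewrite S_gen.
move/(_ [set z | H [~ z, x]]); apply; split; first exact: comm_subgroup.
by move=> a Sa /=; rewrite -invgR; apply/HV/H1.
Qed.

End CommutatorsOfGenerators.

(** The element (class of x) (x) c of M. It is locked because unification would
    otherwise unfold the quotients that define the tensor product. *)
HB.lock Definition alex_tens (C : numClosedFieldType) (G : groupType)
    (x : GQ1_type G) (c : C) : scalar_ext (BQ G) C :=
  tens (abclass (GQ2_kernel G) x : zmodule (BQ G)) (c : zmodule C).

Section AlexanderModule.
Variables (C : numClosedFieldType) (G : groupType).
Local Notation M := (scalar_ext (BQ G) C).
Local Notation A := (Gabf G).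

Definition galg_const (c : C) : galg C A := (c *: << 0 >> : {malg C[A]}).

Lemma alex_tensM (x y : GQ1_type G) (c : C) : alex_tens (x * y)%g c = alex_tens x c + alex_tens y c.
Proof.
rewrite !alex_tens.unlock abclassD.
have := @tens_is_linear_l _ (zmodule (BQ G)) (zmodule C) c 1
   (abclass (GQ2_kernel G) x) (abclass (GQ2_kernel G) y).
by rewrite !scale1r.
Qed.

Lemma alex_tensDr (x : GQ1_type G) (c d : C) : alex_tens x (c + d) = alex_tens x c + alex_tens x d.
Proof.
rewrite !alex_tens.unlock.
have := @tens_is_linear_r _ (zmodule (BQ G)) (zmodule C) (abclass (GQ2_kernel G) x) 1 c d.
by rewrite !scale1r.
Qed.

Lemma alex_tens1 (c : C) : alex_tens (1%g : GQ1_type G) c = 0.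
Proof. by apply: (addrI (alex_tens (1%g : GQ1_type G) c)); rewrite -alex_tensM mulg1 addr0. Qed.

Lemma alex_tens0 (x : GQ1_type G) : alex_tens x (0 : C) = 0.
Proof. by apply: (addrI (alex_tens x (0 : C))); rewrite -alex_tensDr !addr0. Qed.

Lemma alex_tensX (x : GQ1_type G) (c : C) m : alex_tens (x ^+ m)%g c = alex_tens x (m%:R * c).
Proof.
elim: m => [|m IHm]; first by rewrite mul0r alex_tens0; apply: alex_tens1.
have -> : m.+1%:R * c = c + m%:R * c by rewrite mulrS mulrDl mul1r.
by rewrite alex_tensDr -IHm -alex_tensM expgS.
Qed.

Lemma alex_tensZ (x : GQ1_type G) (c d : C) : alex_tens x (c * d) = galg_const c *: alex_tens x d.
Proof. by rewrite !alex_tens.unlock -scalar_ext_constE. Qed.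

Lemma alex_tensJ g (x : GQ1_type G) (c : C) : alex_tens (conjGQ1 g x) c =
  (<< abclass (GQ1_kernel G) g : A >> : galg C A) *: alex_tens x c.
Proof. by rewrite !alex_tens.unlock scalar_extE BQ_scaleE. Qed.

Lemma alex_ind (P : M -> Prop) :
  P 0 -> (forall x c t, P t -> P (alex_tens x c + t)) -> forall t, P t.
Proof.
move=> P0 PD; elim/tens_ind => // a b c t Pt.
have [x bE] : exists x, a *: b = abclass (GQ2_kernel G) x.
  by exists (repr (a *: b : BQ G)); rewrite abclass_repr.
suff -> : a *: tens b c = alex_tens x c by apply: PD.
have := @tens_is_linear_l _ (zmodule (BQ G)) (zmodule C) c a b 0.
have /= := alex_tens1 c; rewrite !alex_tens.unlock -bE => E.
by rewrite addr0 [X in _ + X]E addr0 => <-.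
Qed.

(** Over C the torsion of G'_Q / [G, G] is invisible: if x ^+ m lies in [G, G], then
    x (x) 1 is m^-1 times x ^+ m (x) 1. So M is generated by the classes of [G, G],
    hence by those of the commutators of the generators of G, since [G, G] is
    their normal closure and conjugation acts through C[A]. *)
Lemma alex_finitely_generated : finitely_generated G ->
  exists n (x : 'I_n -> M), spanning x.
Proof.
move=> [s s_gen]; pose comms := [seq [~ a, b]%g | a <- s, b <- s].
pose lift (g : G) : GQ1_type G := insubd (1%g : GQ1_type G) g.
have liftK g : GQ1 g -> GQ1_val (lift g) = g by move=> Gg; apply: insubdK; apply/asboolP.
pose x (i : 'I_(size comms)) := alex_tens (lift (nth 1%g comms i)) (1 : C).
exists (size comms), x.
have [N0 Na] := @combinations_submodule _ M _ x setT I (fun _ _ _ _ _ => I).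
pose N := combinations setT x.
have NZ a t : N t -> N (a *: t) by move=> Nt; rewrite -[_ *: t]addr0; apply: Na.
have ND t u : N t -> N u -> N (t + u) by move=> Nt Nu; rewrite -[t]scale1r; apply: Na.
have Nx i : N (x i).
  exists (fun j => (j == i)%:R) => //; rewrite (bigD1 i) //= eqxx scale1r.
  by rewrite big1 ?addr0 // => j /negPf->; rewrite scale0r.
pose H : set G := [set g | exists2 u, GQ1_val u = g & N (alex_tens u (1 : C))].
have H_sub : subgroup H.
  split=> [|_ _ [u <- Nu] [v <- Nv]|_ [u <- Nu]].
  - by exists 1%g; [exact: GQ1_val1 | rewrite alex_tens1].
  - by exists (u * v)%g; [exact: GQ1_valM | rewrite alex_tensM; apply: ND].
  exists u^-1%g; first exact: GQ1_valV.
  have := alex_tensM u (u^-1)%g (1 : C); rewrite mulgV alex_tens1 => /esym/eqP.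
  by rewrite addrC addr_eq0 => /eqP->; rewrite -scaleN1r; apply: NZ.
have H_normal g h : H g -> H (g ^ h)%g.
  move=> [u <- Nu]; exists (conjGQ1 h^-1%g u); first by rewrite GQ1_val_conj invgK.
  by rewrite alex_tensJ; apply: NZ.
have H_comm a b : a \in s -> b \in s -> H [~ a, b]%g.
  move=> sa sb; exists (lift [~ a, b]%g).
    by apply: liftK; exists 1%N => //; apply: commutatorT_comm.
  have c_ab : [~ a, b]%g \in comms by apply/allpairsP; exists (a, b).
  have idx : (index [~ a, b]%g comms < size comms)%N by rewrite index_mem.
  by have := Nx (Ordinal idx); rewrite /x /= nth_index.
have H_all := comm_generated H_sub H_normal s_gen H_comm.
have N1 u : N (alex_tens u (1 : C)).
  have [m m0 um] := GQ1_valP u.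
  have [v vE Nv] : H (GQ1_val u ^+ m)%g.
    by apply: um; split=> // _ [a [b [_ _ ->]]]; apply: H_all.
  have uv : v = (u ^+ m)%g by apply: GQ1_val_inj; rewrite GQ1_valX vE.
  have -> : (1 : C) = m%:R^-1 * (m%:R * 1).
    by rewrite mulr1 mulVf // pnatr_eq0 -lt0n.
  by rewrite alex_tensZ -alex_tensX -uv; apply: NZ.
suff NT t : N t by move=> t; have [d _ ->] := NT t; exists d.
elim/alex_ind: t => [|u c t Nt]; first exact: N0.
by apply: ND Nt; rewrite -[c]mulr1 alex_tensZ; apply: NZ.
Qed.

End AlexanderModule.

(** * Characters of G and of G_abf *)

Section Characters.
Variables (C : numClosedFieldType) (G : groupType).

Lemma character1 (rho : G -> C) : character_group C G rho -> rho 1%g = 1.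
Proof.
by move=> [rho_neq0 rhoM]; apply: (mulfI (rho_neq0 1%g)); rewrite -rhoM !mulg1 mulr1.
Qed.

Lemma characterX (rho : G -> C) g m : character_group C G rho -> rho (g ^+ m)%g = rho g ^+ m.
Proof.
move=> rhoP; elim: m => [|m IHm]; first exact: character1.
by rewrite expgS exprS rhoP.2 IHm.
Qed.

Lemma characterV (rho : G -> C) g : character_group C G rho -> rho g^-1%g = (rho g)^-1.
Proof.
move=> rhoP; apply: (mulfI (rhoP.1 g)).
by rewrite -rhoP.2 mulgV character1 // mulfV // rhoP.1.
Qed.

Lemma character_GQ1 g : GQ1 g -> exists2 m, (0 < m)%N &
  forall rho : G -> C, character_group C G rho -> rho g ^+ m = 1.
Proof.
move=> [m m0 gm]; exists m => // rho rhoP; rewrite -characterX //.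
have: [set x | rho x = 1] (g ^+ m)%g; last by [].
apply: gm; split=> [|_ [x [y [_ _ ->]]] /=].
  split=> [|x y /= x1 y1|x /= x1]; first exact: character1.
    by rewrite rhoP.2 x1 y1 mulr1.
  by rewrite characterV // x1 invr1.
rewrite commgEl conjgE !rhoP.2 !characterV //.
by rewrite [_^-1 * (_ * _)]mulrCA mulKf ?rhoP.1 // mulVf ?rhoP.1.
Qed.

Lemma character_GQ1_factor (rho : G -> C) :
  character_group C G rho -> (forall g, GQ1 g -> rho g = 1) ->
  exists2 chi, abf_character chi & rho = chi \o abclass (GQ1_kernel G).
Proof.
move=> rhoP rho_GQ1.
have rhoE g : rho (repr (abclass (GQ1_kernel G) g)) = rho g.
  have /abclassP/rho_GQ1 := abclass_repr (abclass (GQ1_kernel G) g).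
  by rewrite rhoP.2 characterV // => /(canRL (mulVKf (rhoP.1 _))); rewrite mulr1.
exists (fun a => rho (repr a)); last by apply/funext => g; rewrite /= rhoE.
split=> [a|]; first exact: rhoP.1.
by elim/abclass_ind=> g; elim/abclass_ind=> h; rewrite -abclassD !rhoE rhoP.2.
Qed.

End Characters.

(** * The Alexander module and first homology *)

Lemma tensor_universal (R : comNzRingType) (M N P : lmodType R) (f : M -> N -> P) :
  (forall n, linear (f^~ n)) -> (forall m, linear (f m)) ->
  exists2 F : tensor M N -> P, linear F & forall m n, F (tens m n) = f m n.
Proof.
move=> fl fr; pose F : {malg R[(M * N)%type]} -> P := mlift (fun p => f p.1 p.2).
have FP : linear F by exact: linearP.
have FB u v : F (u - v) = F u - F v by exact: linearB.
have FU p : F << p >> = f p.1 p.2 by exact: mliftU.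
have F0 : tensor_rel (R := R) (M := M) (N := N) `<=` [set z | F z = 0].
  move=> _ [|] [a [m [m' [n ->]]]] /=; rewrite FB FP !FU /=.
    by rewrite fl subrr.
  by rewrite fr subrr.
have Fclass z : F (repr (modclass (@tensor_rel R M N) z)) = F z.
  apply/eqP; rewrite -subr_eq0 -FB; apply/eqP.
  have /modclassP := modclass_repr (modclass (@tensor_rel R M N) z).
  apply: (span_min (N := [set z | F z = 0])) F0 _; split=> [|a u v /= Fu Fv].
    exact: linear0.
  by rewrite /= FP Fu Fv scaler0 addr0.
exists (fun t => F (repr t)) => [a|m n]; last by rewrite /tens Fclass FU.
elim/modclass_ind=> u; elim/modclass_ind=> v.
by rewrite -linearP !Fclass FP.
Qed.

(** Semilinearity over C[A] may be checked on monomials of C[A] and on additive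
    generators of the module. *)
Lemma semilinear_ext (C : numClosedFieldType) (G : groupType) (chi : Gabf G -> C)
    (chiP : abf_character chi) (M : lmodType (galg C (Gabf G))) (V : lmodType C)
    (I : Type) (e : I -> M) (phi : M -> V) :
  (forall P : M -> Prop, P 0 -> (forall i t, P t -> P (e i + t)) -> forall t, P t) ->
  (forall s t, phi (s + t) = phi s + phi t) -> phi 0 = 0 ->
  (forall c a i, phi (((c *: << a >> : {malg C[Gabf G]}) : galg C (Gabf G)) *: e i) =
     (c * chi a) *: phi (e i)) ->
  forall r s t, phi (r *: s + t) = abf_ev chiP r *: phi s + phi t.
Proof.
move=> ind phiD phi0 phiU r s t; rewrite phiD; congr (_ + _); clear t.
elim/ind: s => [|i t IHt]; first by rewrite !(scaler0, phi0).
rewrite scalerDr !phiD IHt scalerDr; congr (_ + _); clear t IHt.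
elim/malg_ind: r => [|c a r IHr]; first by rewrite scale0r phi0 rmorph0 scale0r.
have -> : abf_ev chiP (c *: << a >> + r) = c * chi a + abf_ev chiP r.
  by apply: etrans (abf_eval_linear _ _ _ _) _; rewrite abf_evalU.
by rewrite [RHS]scalerDl -IHr -phiU -phiD; congr phi; apply: scalerDl.
Qed.

(** With n, u, v standing for the classes of the commutator, g and g0, the hypothesis
    is the expansion of [g g0] in two ways. *)
Lemma commutation_solution (K : fieldType) (V : lmodType K) (a b : K) (n u v : V) :
  b != 1 -> n + (v + b *: u) = u + a *: v ->
  u = - (b - 1)^-1 *: n + ((a - 1) / (b - 1)) *: v.
Proof.
rewrite -subr_eq0 => b1 e; apply: (scalerI b1).
rewrite scalerDr !scalerA mulrN mulfV // scaleN1r mulrCA mulfV // mulr1.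
rewrite !scalerBl !scale1r; have <- : n + (v + b *: u) - u = a *: v.
  by rewrite e addrAC subrr add0r.
by rewrite -!(addrA n) addKr [v + _]addrC [RHS]addrAC addrK.
Qed.

Section Homology.
Variables (C : numClosedFieldType) (G : groupType) (rho : G -> C).
Hypothesis rhoP : character_group C G rho.
Hypothesis rho_GQ1 : forall g, GQ1 g -> rho g = 1.

Definition boundaries : set (chain1 G C) := [set z | exists c, z = bar2 rho c].

(** Classes are taken in the space of all chains modulo boundaries rather than in
    H_1: a single group element is a chain but rarely a cycle, and H_1 embeds in
    this quotient. *)
Definition chain_class (z : chain1 G C) := modclass boundaries z.

(** The universal crossed homomorphism twisted by rho; symbolM is its defining
    relation. *)
Definition symbol (g : G) := chain_class (<< g >> : {malg C[G]}).

Lemma boundaries_submodule : submodule boundaries.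
Proof.
split; first by exists 0; rewrite /bar2 linear0.
by move=> a _ _ [c ->] [d ->]; exists (a *: c + d); rewrite /bar2 linearP.
Qed.

Lemma chain_classP z w : chain_class z = chain_class w <-> boundaries (z - w).
Proof.
rewrite modclassP; split; last exact: sub_span.
by apply: span_min => //; apply: boundaries_submodule.
Qed.

Lemma bar2U g h : bar2 rho << (g, h) >> =
  rho g *: << h >> - << (g * h)%g >> + << g >> :> {malg C[G]}.
Proof. exact: (@mliftU C (G * G)%type {malg C[G]}). Qed.

Lemma symbolM g h : symbol (g * h)%g = symbol g + rho g *: symbol h.
Proof.
rewrite /symbol /chain_class -linearZ -linearD; apply/esym/chain_classP.
by exists (<< (g, h) >> : {malg C[(G * G)%type]}); rewrite bar2U -addrA addrC.
Qed.

Lemma symbol1 : symbol 1%g = 0.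
Proof.
have := symbolM 1 1; rewrite mulg1 (character1 rhoP) scale1r => /esym/eqP.
by rewrite -subr_eq0 addrK => /eqP.
Qed.

Lemma symbolV g : rho g *: symbol g^-1%g = - symbol g.
Proof. by apply/esym/eqP; rewrite eq_sym -addr_eq0 addrC -symbolM mulgV symbol1. Qed.

Lemma symbolM1 g h : GQ1 g -> symbol (g * h)%g = symbol g + symbol h.
Proof. by move=> Gg; rewrite symbolM rho_GQ1 // scale1r. Qed.

Lemma symbolJ g n : GQ1 n -> symbol (n ^ g^-1)%g = rho g *: symbol n.
Proof.
move=> Gn; rewrite conjgE invgK symbolM symbolM1 // scalerDr symbolV.
by rewrite addrCA subrr addr0.
Qed.

Lemma symbolX n m : GQ1 n -> symbol (n ^+ m)%g = symbol n *+ m.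
Proof.
move=> Gn; elim: m => [|m IHm]; first by rewrite symbol1.
by rewrite expgS symbolM1 // IHm mulrS.
Qed.

(** On G'_Q the symbol is additive and invariant under conjugation by G'_Q, so it
    kills commutators; their roots follow as the target is a complex space. *)
Lemma symbol_GQ2 n : GQ1 n -> GQ2 n -> symbol n = 0.
Proof.
move=> Gn [m m0 nm].
have [Gc c0] : [set g | GQ1 g /\ symbol g = 0] (n ^+ m)%g.
  apply: nm; split=> [|_ [x [y [Gx Gy ->]]] /=].
    split=> [|x y /= [Gx x0] [Gy y0]|x /= [Gx x0]].
    - by split; [exact: (ak1 (GQ1_kernel G)) | exact: symbol1].
    - split; first exact: (akM (N := GQ1_kernel G)).
      by rewrite symbolM1 // x0 y0 addr0.
    split; first exact: (akV (N := GQ1_kernel G)).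
    by have := symbolV x; rewrite rho_GQ1 // scale1r x0 oppr0.
  split; first exact: (@ak_comm _ (GQ1_kernel G)).
  have Gxy : GQ1 (x ^ y)%g by exact: GQ1J.
  have Gx' : GQ1 x^-1%g by exact: (akV (N := GQ1_kernel G)).
  rewrite commgEl symbolM1 // -[X in (x ^ X)%g]invgK symbolJ //.
  rewrite rho_GQ1; last exact: (akV (N := GQ1_kernel G)).
  by rewrite scale1r -symbolM1 // mulVg symbol1.
have m1 : m%:R != 0 :> C by rewrite pnatr_eq0 -lt0n.
apply: (scalerI m1); rewrite scaler0 scaler_nat -symbolX //.
Qed.

End Homology.

(** A crossed homomorphism g |-> psi g, twisted by u rather than by rho, respects
    boundaries modulo any submodule N in which the two twists agree. It is used
    with u g the class of g in C[A] and N = m M. *)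
Lemma crossed_map_boundary (C : numClosedFieldType) (G : groupType) (rho : G -> C)
    (R : comNzRingType) (M : lmodType R) (const : C -> R) (u : G -> R)
    (psi : {malg C[G]} -> M) (N : set M) :
  submodule N -> (forall g x, N ((const (rho g) - u g) *: x)) ->
  const (- 1) = - 1 ->
  (forall c z w, psi (c *: z + w) = const c *: psi z + psi w) ->
  (forall g h, psi << (g * h)%g >> = u g *: psi << h >> + psi << g >>) ->
  forall c, N (psi (bar2 rho c)).
Proof.
move=> [N0 NP] Nu const1 psiP psiM.
have psi0 : psi 0 = 0 by have := psiP (-1) 0 0; rewrite const1 scaler0 addr0 scaleN1r addNr.
elim/malg_ind => [|c [g h] z IHz].
  have -> : bar2 rho 0 = 0 by exact: (linear0 (mlift _)).
  by rewrite psi0.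
have -> : bar2 rho (c *: << (g, h) >> + z) =
    c *: (rho g *: << h >> + (-1 *: << (g * h)%g >> + << g >>)) + bar2 rho z :> {malg C[G]}.
  by apply: etrans (mlift_is_linear _ _ _ _) _; rewrite mliftU scaleN1r addrA.
rewrite psiP; apply: NP => //; rewrite !psiP const1 psiM scaleN1r.
by rewrite opprD -addrA addNr addr0 -scalerBl; apply: Nu.
Qed.

Section AlexanderToHomology.
Variables (C : numClosedFieldType) (G : groupType) (chi : Gabf G -> C).
Hypothesis chiP : abf_character chi.
Let rho (g : G) : C := chi (abclass (GQ1_kernel G) g).
Local Notation M := (scalar_ext (BQ G) C).
Local Notation A := (Gabf G).
Local Notation ev := (abf_ev chiP).

Let rhoP : character_group C G rho.
Proof.
case: chiP => chi_neq0 chiD; split=> [g|g h]; first exact: chi_neq0.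
by rewrite /rho abclassD chiD.
Qed.

Let rho_GQ1 g : GQ1 g -> rho g = 1.
Proof.
move=> Gg; rewrite -(abf_character0 chiP) /rho; congr chi.
by have [_ /(_ Gg)] := abclass_eq0 (GQ1_kernel G) g.
Qed.

Definition hclass (z : cycle1 rho) : H1 rho :=
  modclass [set z : cycle1 rho | exists c, val z = bar2 rho c] z.

Lemma hclass_eq0 z : hclass z = 0 <-> boundaries rho (val z).
Proof.
rewrite /hclass modclass_eq0; split; last by move=> bz; apply: sub_span.
apply: (span_min (N := [set z | boundaries rho (val z)])) => //.
have [b0 bP] := boundaries_submodule rho.
by split=> [|a u v]; [exact: b0 | exact: bP].
Qed.

Lemma hclass_eq z w : hclass z = hclass w <-> chain_class rho (val z) = chain_class rho (val w).
Proof.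
rewrite chain_classP -[boundaries _ _]/(boundaries rho (val (z - w))) -hclass_eq0.
by rewrite /hclass linearB /=; split=> [->|/eqP]; rewrite ?subrr // subr_eq0 => /eqP.
Qed.

Lemma hclass_linear a z w : hclass (a *: z + w) = a *: hclass z + hclass w.
Proof. exact: linearP. Qed.

Lemma chain_class_linear a z w :
  chain_class rho (a *: z + w) = a *: chain_class rho z + chain_class rho w.
Proof. exact: linearP. Qed.

Lemma bar1U (c : C) g (z : {malg C[G]}) :
  bar1 rho (c *: << g >> + z) = c * (rho g - 1) + bar1 rho z.
Proof.
by have := mlift_is_linear (fun g => rho g - 1 : C^o) c << g >> z; rewrite mliftU.
Qed.

Fact cycle_GQ1 (n : GQ1_type G) : (<< GQ1_val n >> : {malg C[G]}) \in cycle1_pred rho.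
Proof.
suff b0 : bar1 rho (<< GQ1_val n >> : {malg C[G]}) = 0 by exact/eqP.
by rewrite /bar1 mliftU rho_GQ1 ?subrr //; apply: GQ1_valP.
Qed.

Definition cycle_of (n : GQ1_type G) : cycle1 rho :=
  Sub (<< GQ1_val n >> : {malg C[G]}) (cycle_GQ1 n).

Definition homology_class (n : GQ1_type G) : H1 rho := hclass (cycle_of n).

Lemma homology_classM m n :
  homology_class (m * n)%g = homology_class m + homology_class n.
Proof.
rewrite -[homology_class m]scale1r -hclass_linear; apply/hclass_eq.
rewrite -[val (_ + _)]/(1 *: val (cycle_of m) + val (cycle_of n)) chain_class_linear scale1r !SubK.
rewrite -[chain_class _ _]/(symbol rho (GQ1_val (m * n)%g)) GQ1_valM symbolM1 //.
exact: GQ1_valP.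
Qed.

Lemma homology_classJ g n : homology_class (conjGQ1 g n) = rho g *: homology_class n.
Proof.
rewrite -[RHS]addr0 -[0](_ : hclass 0 = _); last by rewrite /hclass linear0.
rewrite -hclass_linear addr0; apply/hclass_eq.
rewrite -[val (_ *: _)]/(rho g *: val (cycle_of n)) !SubK.
rewrite -[_ *: _]addr0 chain_class_linear GQ1_val_conj.
rewrite -[X in _ + X](_ : 0 = _); last by rewrite /chain_class linear0.
rewrite addr0; apply: symbolJ => //; exact: GQ1_valP.
Qed.

Lemma homology_class_repr n :
  homology_class (repr (abclass (GQ2_kernel G) n)) = homology_class n.
Proof.
have /abclassP := abclass_repr (abclass (GQ2_kernel G) n).
set m := repr _ => mn.
rewrite -[n in RHS](mulVKg m) homology_classM [X in _ + X](_ : _ = 0) ?addr0 //.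
rewrite -[RHS](_ : hclass 0 = _); last by rewrite /hclass linear0.
apply/hclass_eq; rewrite SubK -[val 0]/(0 : {malg C[G]}).
rewrite -[RHS](_ : 0 = _); last by rewrite /chain_class linear0.
apply: symbol_GQ2 => //; exact: GQ1_valP.
Qed.

Lemma alex_tens_scale (c : C) g n d :
  ((c *: << abclass (GQ1_kernel G) g >> : {malg C[A]}) : galg C A) *: alex_tens n d =
  alex_tens (conjGQ1 g n) (c * d).
Proof.
rewrite alex_tensZ alex_tensJ; apply: esym; apply: etrans (scalerA _ _ _) _.
congr (_ *: _); apply: esym.
change (c *: << abclass (GQ1_kernel G) g >> =
  galg_mul (c *: << 0 >> : {malg C[A]}) << abclass (GQ1_kernel G) g >> :> {malg C[A]}).
by rewrite galg_mulZl galg_mulU add0r.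
Qed.

(** The pairing (b, c) |-> c [b] is defined on B_Q(G) because the additive map
    n |-> [n] kills G''_Q, and it is biadditive, so it factors through the tensor
    product; equivariance under conjugation makes it semilinear. *)
Lemma alexander_to_H1 : exists2 phi : M -> H1 rho,
  forall r x y, phi (r *: x + y) = ev r *: phi x + phi y &
  forall n c, phi (alex_tens n c) = c *: homology_class n.
Proof.
pose f (b : zmodule (BQ G)) (c : zmodule C) : zmodule (H1 rho) :=
  (c : C) *: homology_class (repr (b : BQ G)).
have fl c : linear (f^~ c).
  apply: additive_Zlinear; elim/abclass_ind=> x; elim/abclass_ind=> y.
  by rewrite /f -abclassD !homology_class_repr homology_classM scalerDr.
have fr b : linear (f b).
  by apply: additive_Zlinear => x y; rewrite /f scalerDl.
have [F FP FE] := tensor_universal fl fr.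
have FD s t : F (s + t) = F s + F t by have := FP 1 s t; rewrite !scale1r.
have [phi [phiD phi0 phiE]] : exists phi : M -> H1 rho,
    [/\ forall s t, phi (s + t) = phi s + phi t, phi 0 = 0 &
        forall n c, phi (alex_tens n c) = c *: homology_class n].
  exists F; split=> [s t||n c].
  - exact: FD.
  - by apply: (addrI (F 0)); rewrite -FD !addr0.
  by rewrite alex_tens.unlock [LHS]FE /f homology_class_repr.
exists phi => //; apply: (@semilinear_ext C G chi chiP M (H1 rho) (GQ1_type G * C)%type
  (fun p => alex_tens p.1 p.2)) => //.
  by move=> P P0 PD; apply: alex_ind => // n c t; apply: (PD (n, c)).
move=> c a [n d] /=; elim/abclass_ind: a => g.
rewrite phiE; apply: etrans (congr1 phi (alex_tens_scale _ _ _ _)) _.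
by rewrite phiE homology_classJ !scalerA mulrAC.
Qed.

Variable g0 : G.

(** The element g g0 g^-1 g0^-1. *)
Definition comm_with (g : G) : GQ1_type G := insubd (1%g : GQ1_type G) [~ g^-1, g0^-1]%g.

Lemma comm_withE g : GQ1_val (comm_with g) = [~ g^-1, g0^-1]%g.
Proof. by apply: insubdK; apply/asboolP; exact: (@ak_comm _ (GQ1_kernel G)). Qed.

Lemma comm_withM g h : comm_with (g * h)%g = (conjGQ1 g (comm_with h) * comm_with g)%g.
Proof.
apply: GQ1_val_inj; rewrite GQ1_valM GQ1_val_conj !comm_withE.
by rewrite !commgEl !conjgE !invgK invgM -!mulgA !(mulVKg, mulKg).
Qed.

Lemma comm_with_GQ1 n : comm_with (GQ1_val n) = (n * conjGQ1 g0 n^-1)%g.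
Proof.
apply: GQ1_val_inj; rewrite GQ1_valM GQ1_val_conj comm_withE GQ1_valV.
by rewrite commgEl invgK.
Qed.

Hypothesis rho_g0 : rho g0 != 1.

Let d0 : rho g0 - 1 != 0. Proof. by rewrite subr_eq0. Qed.

(** From g g0 = (g g0 g^-1 g0^-1) (g0 g). *)
Lemma symbol_comm_with g : symbol rho g =
  - (rho g0 - 1)^-1 *: symbol rho (GQ1_val (comm_with g)) +
    ((rho g - 1) / (rho g0 - 1)) *: symbol rho g0.
Proof.
apply: commutation_solution => //.
have /esym -> := symbolM rho g g0; have /esym -> := symbolM rho g0 g.
by rewrite [in RHS]commgCV -comm_withE (symbolM1 rho_GQ1 _ (GQ1_valP _)).
Qed.

Variable phi : M -> H1 rho.
Hypothesis phiP : forall r x y, phi (r *: x + y) = ev r *: phi x + phi y.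
Hypothesis phiE : forall n c, phi (alex_tens n c) = c *: homology_class n.

(** Up to the image of phi, a chain z is a multiple of g0, with coefficient
    proportional to bar1 z; this vanishes for a cycle. *)
Lemma alexander_to_H1_surj v : exists t, phi t = v.
Proof.
have phiD x y : phi (x + y) = phi x + phi y.
  by have := phiP 1 x y; rewrite scale1r rmorph1 scale1r.
suff H z : exists t w, phi t = hclass w /\
    chain_class rho z = chain_class rho (val w) + (bar1 rho z / (rho g0 - 1)) *: symbol rho g0.
  elim/modclass_ind: v => z; have [t [w [tw zw]]] := H (val z).
  exists t; rewrite tw; apply/hclass_eq; rewrite zw.
  by have /eqP-> := valP z; rewrite mul0r scale0r addr0.
elim/malg_ind: z => [|c g z [t [w [tw zw]]]].
  exists 0, 0; split; first by apply: (addrI (phi 0)); rewrite -phiD addr0 /hclass linear0 addr0.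
  by rewrite [bar1 _ _](linear0 (mlift _)) mul0r scale0r addr0.
pose b := c * - (rho g0 - 1)^-1.
exists (alex_tens (comm_with g) b + t), (b *: cycle_of (comm_with g) + w); split.
  by rewrite phiD phiE tw hclass_linear.
rewrite chain_class_linear -[chain_class _ << g >>]/(symbol rho g) symbol_comm_with bar1U zw.
have -> : chain_class rho (val (b *: cycle_of (comm_with g) + w)) =
    b *: symbol rho (GQ1_val (comm_with g)) + chain_class rho (val w).
  exact: chain_class_linear.
rewrite scalerDr !scalerA -/b.
have -> : (c * (rho g - 1) + bar1 rho z) / (rho g0 - 1) =
    c * ((rho g - 1) / (rho g0 - 1)) + bar1 rho z / (rho g0 - 1).
  by rewrite mulrDl mulrA.
by rewrite [(_ + _) *: symbol rho g0]scalerDl addrACA.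
Qed.

Lemma galg_const_scale c (t : tensorZ (BQ G) C) :
  galg_const G c *: (t : M) = (c *: t : tensorZ (BQ G) C).
Proof.
change (galg_scale (@tensorZ_act _ (BQ G) C) (galg_const G c) t = c *: t).
by rewrite galg_scaleZl galg_scaleU tensorZ_act0.
Qed.

(** The factor is the one of symbol_comm_with, for psi to be inverse to phi. *)
Lemma homology_to_alexander : exists psi : {malg C[G]} -> M,
  (forall c z w, psi (c *: z + w) = galg_const G c *: psi z + psi w) /\
  forall g, psi << g >> = alex_tens (comm_with g) (- (rho g0 - 1)^-1).
Proof.
pose tau g : tensorZ (BQ G) C := alex_tens (comm_with g) (- (rho g0 - 1)^-1).
exists (mlift tau); split=> [c z w|g]; last exact: (mliftU tau g).
apply: etrans (mlift_is_linear tau c z w) _.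
by apply: (congr1 (fun t : M => t + mlift tau w)); apply/esym/galg_const_scale.
Qed.

(** psi inverts phi modulo m M: every t in M is represented by a cycle w with
    psi w congruent to t, and psi w lies in m M when w is a boundary. *)
Lemma alexander_to_H1_ker x : phi x = 0 ->
  submod_span [set y | exists2 r, ev r = 0 & exists z, y = r *: z] x.
Proof.
set N := submod_span _.
have [N0 NP] : submodule N by exact: span_submodule.
have Nev r y : ev r = 0 -> N (r *: y).
  by move=> r0; apply: sub_span; exists r => //; exists y.
have [psi [psiP psiU]] := homology_to_alexander.
have constN1 : galg_const G (-1 : C) = -1 by exact: scaleN1r.
have psi0 : psi 0 = 0.
  by have := psiP (-1) 0 0; rewrite constN1 scaler0 addr0 scaleN1r addNr.
have psi_bd c : N (psi (bar2 rho c)).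
  apply: (@crossed_map_boundary _ _ rho _ _ (galg_const G (C := C))
    (fun g => << abclass (GQ1_kernel G) g >> : galg C A)) => // [g y|g h].
    by apply: Nev; rewrite rmorphB abf_ev_const [ev _]abf_evalU subrr.
  by rewrite !psiU comm_withM alex_tensM alex_tensJ.
have ND s t : N s -> N t -> N (s + t) by move=> Ns Nt; rewrite -[s]scale1r; apply: NP.
have NZ r s : N s -> N (r *: s) by move=> Ns; rewrite -[_ *: s]addr0; apply: NP.
(* For n in G'_Q the commutator of n^-1 and g0^-1 has class (1 - g0) n, and 1 - g0
   evaluates to 1 - rho g0. *)
have psi_n n c : N (galg_const G c *: psi << GQ1_val n >> - alex_tens n c).
  rewrite psiU comm_with_GQ1; set e := - _^-1.
  have -> : alex_tens n c = galg_const G c *: (galg_const G (1 - rho g0) *: alex_tens n e).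
    rewrite -!alex_tensZ; congr alex_tens.
    by rewrite /e -opprB mulrNN mulfV // mulr1.
  have nV : alex_tens (n^-1)%g e = - alex_tens n e.
    by apply/eqP; rewrite -addr_eq0 -alex_tensM mulVg alex_tens1.
  rewrite alex_tensM alex_tensJ nV.
  have -> (M' : lmodType (galg C A)) (y : M') a b d :
      a *: (y + b *: - y) - a *: (d *: y) = a *: ((1 - b - d) *: y).
    by rewrite -scalerBr !scalerBl scale1r scalerN.
  apply: NZ; apply: Nev; rewrite !rmorphB rmorph1 abf_ev_const [ev << _ >>]abf_evalU.
  by rewrite -/(rho g0) subrr.
suff H t : exists w, phi t = hclass w /\ N (psi (val w) - t).
  move=> x0; have [w [xw Nw]] := H x.
  have /hclass_eq0[c wc] : hclass w = 0 by rewrite -xw.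
  have Nb : N (psi (val w)) by rewrite wc.
  rewrite -(subKr (psi (val w)) x) -[- (_ - x)]scaleN1r.
  by apply: ND Nb _; apply: NZ.
elim/alex_ind: t => [|n c t [w [tw Nw]]].
  exists 0; split; last by rewrite [val _](_ : _ = 0) // psi0 subrr.
  have := phiP (-1) 0 0; rewrite scaler0 addr0 rmorphN rmorph1 scaleN1r addNr => ->.
  by rewrite /hclass linear0.
exists (c *: cycle_of n + w); split.
  have := phiP 1 (alex_tens n c) t; rewrite scale1r rmorph1 scale1r => ->.
  by rewrite phiE tw hclass_linear.
have -> : psi (val (c *: cycle_of n + w)) = galg_const G c *: psi << GQ1_val n >> + psi (val w).
  exact: psiP.
by rewrite opprD addrACA; apply: ND (psi_n n c) Nw.
Qed.
End AlexanderToHomology.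

(** * The identity component of the character group *)

Section FieldContinuity.
Variables (K : numFieldType) (T : Type) (F : set_system T).
Context {FF : Filter F}.

Lemma cvg_exprn (f : T -> K) (a : K) n :
  f @ F --> a -> (fun x => f x ^+ n) @ F --> a ^+ n.
Proof.
move=> fa; elim: n => [|n IHn]; first by under eq_fun do rewrite expr0; exact: cvg_cst.
by rewrite exprS; under eq_fun do rewrite exprS; exact: cvgM.
Qed.

Lemma cvg_exprz (f : T -> K) (a : K) (z : int) :
  a != 0 -> f @ F --> a -> (fun x => f x ^ z) @ F --> a ^ z.
Proof.
move=> a0 fa; case: z => n; first exact: cvg_exprn.
by apply: cvgV; [rewrite expf_neq0 | exact: cvg_exprn].
Qed.

End FieldContinuity.

Lemma closed_point (K : numFieldType) (x : K) : closed [set x].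
Proof. exact/accessible_closed_set1/hausdorff_accessible/norm_hausdorff. Qed.

Section IdentityComponentSub.
Variables (C : numClosedFieldType) (G : groupType).

Lemma eval_continuous g : continuous (fun rho : {ptws G -> C} => rho g).
Proof. exact: (@proj_continuous G (fun=> C) g). Qed.

(** On a connected set B of characters containing 1, the value z at g satisfies
    z ^+ m = 1. The condition z = 1 is closed, and it is also open because it
    amounts to 1 + z + ... + z ^+ (m - 1) != 0. *)
Lemma character_group0_GQ1 (rho : G -> C) : character_group0 C G rho ->
  forall g, GQ1 g -> rho g = 1.
Proof.
move=> [B [B1 Bchar Bconn] Brho] g Gg.
have [m m0 gm] := character_GQ1 C Gg.
pose ev (sigma : {ptws G -> C}) := sigma g.
have ev_cont : continuous ev by exact: eval_continuous.
pose q (z : C) := \sum_(i < m) z ^+ i.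
have q_cont : continuous q.
  apply: continuous_big; first exact: add_continuous.
  by move=> i _ z; exact: (@cvg_exprn C C (nbhs z) _ id z i cvg_id).
suff E : B `&` [set sigma | ev sigma = 1] = B.
  by have [] : (B `&` [set sigma | ev sigma = 1]) rho by rewrite E.
apply: Bconn; first by exists (fun=> 1).
  exists [set sigma | q (ev sigma) != 0].
    have qev : continuous (q \o ev).
      by move=> sigma; apply: (continuous_comp (ev_cont sigma)); apply: q_cont.
    rewrite (_ : [set _ | _] = (q \o ev) @^-1` (~` [set 0])).
      apply: ((continuousP (q \o ev)).1 qev _ _).
      by apply: closed_openC; apply: closed_point.
    by apply/seteqP; split=> sigma /eqP.
  apply/seteqP; split=> sigma /= [Bs].
    move=> sg1; split=> //; rewrite sg1 /q.
    under eq_bigr do rewrite expr1n.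
    by rewrite sumr_const card_ord pnatr_eq0 -lt0n.
  move=> q0; split=> //; apply/eqP; rewrite -subr_eq0.
  have := subrX1 (ev sigma) m; rewrite (gm _ (Bchar _ Bs)) subrr => /esym/eqP.
  by rewrite mulf_eq0 (negPf q0) orbF.
exists [set sigma | ev sigma = 1] => //.
apply: ((continuous_closedP ev).1 ev_cont [set 1] _); apply: closed_point.
Qed.

End IdentityComponentSub.

Section FreeAbelian.
Variable A : zmodType.

Definition zgenerating n (e : 'I_n -> A) : Prop :=
  forall a, exists c : 'I_n -> int, a = \sum_i e i *~ c i.

Definition zindependent n (e : 'I_n -> A) : Prop :=
  forall c : 'I_n -> int, \sum_i e i *~ c i = 0 -> forall i, c i = 0.

(** The elementary change of generators e j := e j + s e i and the matching change
    of coefficients c i := c i - s (c j). *)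
Lemma zsum_transvection n (e : 'I_n -> A) (c : 'I_n -> int) i j s : i != j ->
  \sum_l (if l == j then e j + e i *~ s else e l) *~ (if l == i then c i - s * c j else c l)
  = \sum_l e l *~ c l.
Proof.
move=> ij; rewrite (bigD1 i) //= (bigD1 j) //= 1?eq_sym //.
rewrite [RHS](bigD1 i) //= [in RHS](bigD1 j) /=; last by rewrite eq_sym.
rewrite !eqxx [j == i]eq_sym (negPf ij) !addrA; congr (_ + _).
  by rewrite mulrzBr mulrzDl -mulrzA [e j *~ _ + _]addrC addrA subrK.
by apply: eq_bigr => l /andP[/negPf-> /negPf->].
Qed.

(** A generating family of least size is free. Otherwise take a nonzero relation;
    transvections decrease the sum of the absolute values of its coefficients as
    long as two of them are nonzero, and a relation with a single nonzero
    coefficient kills a generator, which can then be dropped. *)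
Lemma torsion_free_basis n (e : 'I_n -> A) : zgenerating e ->
  (forall (a : A) m, (0 < m)%N -> a *+ m = 0 -> a = 0) ->
  exists d (b : 'I_d -> A), zgenerating b /\ zindependent b.
Proof.
move=> e_gen A_tf; pose P d := `[< exists b : 'I_d -> A, zgenerating b >].
have exP : exists d, P d by exists n; apply/asboolP; exists e.
have [d /asboolP[b b_gen] dmin] := ex_minnP exP; clear n e e_gen exP.
exists d, b; split=> // c c0 i; apply/eqP; apply: contraT => ci.
have [m cm] := ubnP (\sum_j `|c j|%N).
elim: m c b b_gen c0 cm i ci => // m IHm c b b_gen c0 cm i ci.
have [/existsP[j /andP[ij cj]]|] := boolP [exists j, (i != j) && (c j != 0)].
  wlog le_c : i j ci cj ij / (`|c j| <= `|c i|)%N.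
    move=> W; case/orP: (leq_total `|c j|%N `|c i|%N) => h; first exact: (W i j).
    by apply: (W j i) => //; rewrite eq_sym.
  (* The sign that makes the coefficient of b i smaller: |c i - s (c j)| = |c i| - |c j|. *)
  pose s : int := if (0 < c i) == (0 < c j) then 1 else -1.
  apply: (IHm (fun l => if l == i then c i - s * c j else c l)
              (fun l => if l == j then b j + b i *~ s else b l)) (j) _.
  - move=> a; have [a' ->] := b_gen a.
    by exists (fun l => if l == i then a' i - s * a' j else a' l); rewrite zsum_transvection.
  - by rewrite zsum_transvection.
  - rewrite -ltnS; apply: leq_trans cm; rewrite ltnS (bigD1 i) //.
    rewrite [in X in (_ <= X)%N](bigD1 i) //= eqxx.
    rewrite -addSn leq_add //; first by rewrite /s; case: ifP; lia.
    by apply: leq_sum => l /negPf->.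
  by rewrite [j == i]eq_sym (negPf ij).
rewrite negb_exists => /forallP c_i.
have cj j : j != i -> c j = 0.
  by move=> ji; apply/eqP; have := c_i j; rewrite eq_sym ji negbK.
have bi : b i = 0.
  move: c0; rewrite (bigD1 i) //= big1 ?addr0 => [c0|j /cj->]; last by rewrite mulr0z.
  case: (c i) ci c0 => k k0 bk; first by apply: (A_tf _ k) => //; rewrite lt0n.
  by apply: (A_tf _ k.+1) => //; apply/eqP; rewrite -oppr_eq0; apply/eqP.
case: d b {dmin c c0 cm ci cj c_i} i b_gen bi dmin IHm => [b []//|d b i b_gen bi dmin _].
suff /asboolP/dmin : exists b : 'I_d -> A, zgenerating b by rewrite ltnn.
exists (fun l => b (lift i l)) => a; have [c ->] := b_gen a.
exists (fun l => c (lift i l)); by rewrite (bigD1_ord i) //= bi mul0rz add0r.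
Qed.

End FreeAbelian.

Section AbelianizationBasis.
Variable G : groupType.

Lemma Gabf_torsion_free (a : Gabf G) m : (0 < m)%N -> a *+ m = 0 -> a = 0.
Proof.
elim/abclass_ind: a => g m0 am; apply/(abclass_eq0 (GQ1_kernel G)).
have [n n0 gn] : GQ1 (g ^+ m)%g.
  by apply/(abclass_eq0 (GQ1_kernel G)); rewrite abclassX.
by exists (m * n)%N; rewrite ?muln_gt0 ?m0 // expgnA.
Qed.

Lemma Gabf_generating : finitely_generated G ->
  exists n (e : 'I_n -> Gabf G), zgenerating e.
Proof.
move=> [s s_gen]; pose cl g : Gabf G := abclass (GQ1_kernel G) g.
pose e (i : 'I_(size s)) := cl (nth 1%g s i).
exists (size s), e; elim/abclass_ind => g.
have : generated [set` s] g by rewrite s_gen.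
move/(_ [set g | exists c : 'I_(size s) -> int, cl g = \sum_i e i *~ c i]); apply.
split; first split=> [|x y [c xc] [d yd]|x [c xc]].
- by exists (fun=> 0); rewrite big1 // => i _; rewrite mulr0z.
- exists (fun i => c i + d i); rewrite [LHS]abclassD [X in X + _]xc [X in _ + X]yd -big_split /=.
  by apply: eq_bigr => i _; rewrite mulrzDr.
- exists (fun i => - c i); rewrite [LHS]abclassN [X in - X]xc -sumrN.
  by apply: eq_bigr => i _; rewrite mulrNz.
move=> x sx; have idx : (index x s < size s)%N by rewrite index_mem.
exists (fun i => (i == Ordinal idx)%:R).
rewrite (bigD1 (Ordinal idx)) //= eqxx mulr1z big1 ?addr0; first by rewrite /e /= nth_index.
by move=> i /negPf->; rewrite mulr0z.
Qed.

Lemma Gabf_basis : finitely_generated G ->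
  exists n (e : 'I_n -> Gabf G), zgenerating e /\ zindependent e.
Proof.
by move=> /Gabf_generating[n [e e_gen]]; apply: torsion_free_basis e_gen Gabf_torsion_free.
Qed.

End AbelianizationBasis.

Lemma pointwise_cvg (T U : Type) (V : topologicalType) (F : set_system T) (FF : Filter F)
    (f : T -> {ptws U -> V}) (l : {ptws U -> V}) :
  (forall u, (fun t => f t u) @ F --> l u) -> f @ F --> l.
Proof.
move=> fl; apply/cvg_sup => u; apply/cvg_image.
  by rewrite eqEsubset; split=> v // _; exists (fun=> v).
move=> W /= /fl Wf; exists (@^~ u @^-1` W) => //.
by rewrite eqEsubset; split => [j [? + <-//]|j Wj]; exists (fun=> j).
Qed.

Section CharacterPath.
Variables (R : realType).
(* The topology is the one attached to any numClosedFieldType. *)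
Let C : numClosedFieldType := R[i].
Local Open Scope complex_scope.

Lemma real_complex_continuous : continuous (fun t : R => t%:C : C).
Proof.
move=> t; apply/cvgrPdist_lt => e e0.
have [d dE] : exists d : R, e = d%:C by apply/complex_realP/gtr0_real.
have d0 : 0 < d by rewrite -ltcR -dE.
have : \forall s \near t, `|t - s| < d by apply: (@cvgr_dist_lt _ _ _ (nbhs t) _ id t cvg_id d).
apply: filterS => s st; rewrite -rmorphB /= dE normc_def /= expr0n addr0.
by rewrite sqrtr_sqr ltcR.
Qed.

(** A square root in the right half-plane can be joined to 1 by a segment avoiding
    0, whereas z itself might be a negative real number. *)
Lemma complex_sqrt_right (z : C) : exists w : C, w ^+ 2 = z /\ 0 <= complex.Re w.
Proof.
have [h|h] := lerP 0 (complex.Re (sqrtC z)); first by exists (sqrtC z); rewrite sqrtCK.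
exists (- sqrtC z); split; first by rewrite sqrrN sqrtCK.
by case: (sqrtC z) h => a b /= /ltW; rewrite oppr_ge0.
Qed.

Lemma segment_neq0 (w : C) (t : R) : w != 0 -> 0 <= complex.Re w -> 0 <= t <= 1 ->
  (1 - t)%:C + t%:C * w != 0.
Proof.
case: w => a b w0 /= a0 /andP[t0 t1]; apply/eqP => /eqP; rewrite eq_complex /=.
rewrite !mul0r subr0 addr0 => /andP[/eqP re0 /eqP im0].
have t1' : 1 - t = 0.
  apply/eqP; rewrite eq_le subr_ge0 t1 andbT -re0 lerDl mulr_ge0 //.
move: w0; rewrite eq_complex /=.
have tE : t = 1 by apply/eqP; rewrite eq_sym -subr_eq0 t1'.
move: re0 im0; rewrite tE subrr !mul1r !add0r => -> ->; by rewrite eqxx.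
Qed.

Variables (G : groupType) (chi : Gabf G -> C).
Hypothesis chiP : abf_character chi.

Lemma abf_characterX a (n : int) : chi (a *~ n) = chi a ^ n.
Proof.
have [chi_neq0 chiD] := chiP.
have chiX b m : chi (b *+ m) = chi b ^+ m.
  elim: m => [|m IHm]; first by rewrite (abf_character0 chiP).
  by rewrite mulrS chiD IHm exprS.
case: n => m; first exact: chiX.
apply: (mulfI (chi_neq0 (a *+ m.+1))); rewrite -chiD.
by rewrite NegzE -nmulrn subrr (abf_character0 chiP) chiX -exprnN mulfV // expf_neq0.
Qed.

Lemma abf_character_sum n (e : 'I_n -> Gabf G) (c : 'I_n -> int) :
  chi (\sum_i e i *~ c i) = \prod_i chi (e i) ^ c i.
Proof.
elim/big_rec2: _ => [|i y z _ <-]; first exact: abf_character0.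
by rewrite chiP.2 abf_characterX.
Qed.

(** Let w i be a square root with nonnegative real part of the value of chi at the
    i-th basis vector. The character with value ((1 - t) + t w i)^2 there runs
    from 1 to chi as t goes from 0 to 1. *)
Lemma character_group0_abf : finitely_generated G ->
  character_group0 C G (chi \o abclass (GQ1_kernel G)).
Proof.
move=> /Gabf_basis[n [e [e_gen e_free]]].
have [w wP] := choice (fun i => complex_sqrt_right (chi (e i))).
have w_neq0 i : w i != 0.
  by rewrite -sqrf_eq0 (wP i).1; apply: chiP.1.
have [c cE] := choice e_gen.
have cD a b i : c (a + b) i = c a i + c b i.
  apply/eqP; rewrite -subr_eq0; apply/eqP; move: i; apply: e_free.
  under eq_bigr do rewrite mulrzBr mulrzDr.
  by rewrite sumrB big_split /= -!cE subrr.
pose p i (t : R) : C := (1 - t)%:C + t%:C * w i.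
have p_neq0 i t : 0 <= t <= 1 -> p i t != 0.
  by move=> t01; apply: segment_neq0 => //; exact: (wP i).2.
pose gamma (t : R) : {ptws G -> C} :=
  fun g => \prod_i (p i t ^+ 2) ^ c (abclass (GQ1_kernel G) g) i.
have gamma0 : gamma 0 = fun=> 1.
  apply/funext => g; rewrite /gamma big1 // => i _.
  by rewrite /p subr0 mul0r addr0 expr1n exp1rz.
have gamma1 : gamma 1 = chi \o abclass (GQ1_kernel G).
  apply/funext => g; rewrite /gamma /= [in RHS](cE (abclass _ g)) abf_character_sum.
  by apply: eq_bigr => i _; rewrite /p subrr add0r mul1r (wP i).1.
exists (gamma @` `[0, 1]); last by exists 1 => //=; rewrite in_itv /= ler01 lexx.
split.
- by exists 0 => //=; rewrite in_itv /= ler01 lexx.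
- move=> sigma [t]; rewrite /= in_itv /= => t01 <-; split=> [g|g h].
    by apply/prodf_neq0 => i _; rewrite expfz_neq0 // expf_neq0 // p_neq0.
  rewrite /gamma -big_split; apply: eq_bigr => i _ /=.
  by rewrite abclassD cD expfzDr // expf_neq0 // p_neq0.
apply: connected_continuous_connected; first exact: segment_connected.
apply: continuous_in_subspaceT => t /set_mem /=; rewrite in_itv /= => t01.
apply: pointwise_cvg => g; apply: cvg_big => [|i _]; first exact: mul_continuous.
apply: cvg_exprz; first by rewrite expf_neq0 // p_neq0.
apply: cvg_exprn; apply: cvgD.
  apply: (cvg_comp _ (fun t => t%:C : C)); last exact: real_complex_continuous.
  by apply: cvgB; [exact: cvg_cst | exact: cvg_id].
by apply: cvgM; [exact: real_complex_continuous | exact: cvg_cst].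
Qed.

End CharacterPath.

(** * The characteristic varieties *)

Lemma localized_alexander_extpow (C : numClosedFieldType) (G : groupType)
    (chi : Gabf G -> C) (chiP : abf_character chi) k : finitely_generated G ->
  chi \o abclass (GQ1_kernel G) <> (fun=> 1) ->
  module_support (extpow (scalar_ext (BQ G) C) k) [set f | abf_eval chi f = 0] <->
  dim_ge (H1 (chi \o abclass (GQ1_kernel G))) k.
Proof.
move=> G_fg rho1.
have [g0 g0P] : exists g0, chi (abclass (GQ1_kernel G) g0) != 1.
  apply: contrapT => /forallNP no; apply: rho1; apply/funext => g.
  by have /negP/negPn/eqP := no g.
have ev_surj c : exists r, abf_ev chiP r = c by exists (galg_const G c); exact: abf_ev_const.
have [n [x xs]] := alex_finitely_generated C G_fg.
have [phi phiP phiE] := alexander_to_H1 chiP.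
have surj := alexander_to_H1_surj g0P phiP phiE.
have ker := alexander_to_H1_ker g0P phiP phiE.
have [Lr Ll] := localized_extpow_neq0 ev_surj phiP surj ker k xs.
split=> [[_ /Lr]//|/Ll]; split=> //; exact: (ker_maximal ev_surj).
Qed.

Theorem theorem12p9 (R : realType) (G : groupType)
    (G_fg : finitely_generated G) (k : nat) (k_ge1 : (1 <= k)%N) :
  Wk R[i] G k `\ (fun=> 1) =
  support_T0 (extpow (scalar_ext (BQ G) R[i]) k) `\ (fun=> 1).
Proof.
apply/seteqP; split=> rho [H rho1]; split=> //; move: H.
  move=> [[rhoP rho_dim] rho0].
  have [chi chiP rhoE] := character_GQ1_factor rhoP (character_group0_GQ1 rho0).
  exists chi; split; [exact: chiP | exact: rhoE |].
  by apply: (localized_alexander_extpow chiP k G_fg _).2; rewrite -rhoE.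
move=> [chi [chiP rhoE supp]].
have rho0 : character_group0 R[i] G rho by rewrite rhoE; exact: character_group0_abf.
split; last exact: rho0.
split; first exact: connected_component_sub rho0.
rewrite rhoE; apply: (localized_alexander_extpow chiP k G_fg _).1 supp.
by rewrite -rhoE.
Qed.
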